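(* There exists an absolute constant $C$ (not depending on $n$ or $r$) such that the following holds. Let $\delta>0$, let $x\in\mathbb{R}^n$, and let $f:\mathbb{R}^n\to\mathbb{R}$ be twice continuously differentiable. Suppose there exists a symmetric matrix $H\in\mathbb{R}^{n\times n}$ with $\operatorname{rank}(H)=r$ such that $\|H-\nabla^2 f(x)\|\le\epsilon$ for some $\epsilon\ge0$, and such that for $u,v$ independent and uniformly distributed on the unit sphere $\mathbb{S}^{n-1}\subset\mathbb{R}^n$, $$\frac{f(x+\delta v+\delta u)-f(x-\delta v+\delta u)-f(x+\delta v-\delta u)+f(x-\delta v-\delta u)}{4\delta^2}\,uv^\top=_d uu^\top H vv^\top .$$ Let $M$ be a positive integer, let $u_1,\dots,u_M,v_1,\dots,v_M$ be independent and uniformly distributed on $\mathbb{S}^{n-1}$, and let $\mathcal{S}:=\frac1M\sum_{i=1}^M\mathcal{P}_i$ with $\mathcal{P}_i:A\mapsto n^2u_iu_i^\top A v_iv_i^\top$. If $M> C\,nr^2\log^2 n$, then with probability exceeding $1-\frac1n$, the solution $\widehat H$ of $$\min_{\widehat H\in\mathbb{R}^{n\times n}}\|\widehat H\|_1\quad\text{subject to}\quad\mathcal{S}\widehat H=\mathcal{S}H$$ satisfies $\|\widehat H-\nabla^2 f(x)\|\le\epsilon$.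
   Context: $\|\cdot\|$ is the operator norm (Schatten $\infty$-norm) and $\|\cdot\|_1$ the trace norm (Schatten $1$-norm) of a matrix. $=_d$ denotes equality in distribution. $\log^2 n$ means $(\log n)^2$. Each $\mathcal{P}_i H$ plays the role of one zeroth-order finite-difference measurement. *)

(* Defs.v *)
From HB Require Import structures.
From mathcomp Require Import all_boot all_order all_algebra.
From mathcomp Require Import all_classical all_reals all_analysis.
Set Implicit Arguments.
Unset Strict Implicit.
Unset Printing Implicit Defensive.
Import Order.TTheory GRing.Theory Num.Theory.
Import numFieldNormedType.Exports.
Local Open Scope classical_set_scope.
Local Open Scope ring_scope.

(* Real matrices (hence column vectors) carry their Borel sigma-algebra. *)
HB.instance Definition _ (R : realType) (m n : nat) :=
  @isMeasurable.Build (sigma_display (@open 'M[R]_(m, n))) 'M[R]_(m, n)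
    <<s @open 'M[R]_(m, n) >> (@sigma_algebra0 _ setT _)
    (@sigma_algebraC _ _) (@sigma_algebra_bigcup _ setT _).

Section Norms.
Context {R : realType}.

Definition l2norm n (v : 'cV[R]_n) : R := Num.sqrt (\sum_i v i ord0 ^+ 2).

(* The norm that the library puts on matrices is the entrywise sup norm, so
   the operator norm induced by [l2norm] is defined separately. *)
Definition opnorm m n (A : 'M[R]_(m, n)) : R :=
  sup [set l2norm (A *m v) | v in [set v : 'cV[R]_n | l2norm v <= 1]].

Definition psdmx n (B : 'M[R]_n) : Prop :=
  B^T = B /\ forall v : 'cV[R]_n, 0 <= (v^T *m B *m v) ord0 ord0.

(* |A| = (A^T A)^(1/2): the positive semidefinite square root of A^T A exists
   and is unique, so [xget] selects it and its default value is irrelevant. *)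
Definition absmx n (A : 'M[R]_n) : 'M[R]_n :=
  xget 0 [set B : 'M[R]_n | psdmx B /\ B *m B = A^T *m A].

Definition trace_norm n (A : 'M[R]_n) : R := \tr (absmx A).

End Norms.

Section Calculus.
Context {R : realType} {n : nat}.
Implicit Types f : 'cV[R]_n -> R.

Definition partial f (i : 'I_n) : 'cV[R]_n -> R := 'D_(delta_mx i ord0) f.

Definition C1 f : Prop := forall i,
  (forall x, derivable f x (delta_mx i ord0)) /\ continuous (partial f i).

Definition C2 f : Prop := C1 f /\ forall i, C1 (partial f i).

Definition hessian f (x : 'cV[R]_n) : 'M[R]_n :=
  \matrix_(i, j) partial (partial f j) i x.

End Calculus.

Section Probability.
Context {R : realType} {d : measure_display} {T : measurableType d}.
Variable P : probability T R.

Definition eq_in_law d' (T' : measurableType d') (X Y : T -> T') : Prop :=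
  forall A : set T', measurable A -> P (X @^-1` A) = P (Y @^-1` A).

Definition mutually_independent d' (T' : measurableType d') (I : finType)
    (X : I -> {RV P >-> T'}) : Prop :=
  forall (J : {set I}) (A : I -> set T'), (forall i, measurable (A i)) ->
    P (\bigcap_(i in [set` J]) (X i @^-1` A i)) =
    (\prod_(i in J) P (X i @^-1` A i))%E.

(* The uniform distribution on the unit sphere is the unique Borel probability
   measure carried by the sphere that is invariant under orthogonal maps. *)
Definition uniform_on_sphere n (u : {RV P >-> 'cV[R]_n}) : Prop :=
  P [set w | l2norm (u w) = 1] = 1%E /\
  forall Q : 'M[R]_n, Q^T *m Q = 1%:M -> eq_in_law (fun w => Q *m u w) u.

Definition indep_uniform_pair n (u v : {RV P >-> 'cV[R]_n}) : Prop :=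
  [/\ uniform_on_sphere u, uniform_on_sphere v &
      mutually_independent (fun b : bool => if b then u else v)].

Definition indep_uniform_samples n M (u v : 'I_M -> {RV P >-> 'cV[R]_n}) : Prop :=
  [/\ forall i, uniform_on_sphere (u i), forall i, uniform_on_sphere (v i) &
      mutually_independent (fun k : 'I_M + 'I_M =>
        match k with inl i => u i | inr i => v i end)].

End Probability.

Section Measurements.
Context {R : realType} {n : nat}.

Definition second_difference (f : 'cV[R]_n -> R) (delta : R)
    (x u v : 'cV[R]_n) : R :=
  (f (x + delta *: v + delta *: u) - f (x - delta *: v + delta *: u)
   - f (x + delta *: v - delta *: u) + f (x - delta *: v - delta *: u))
  / (4 * delta ^+ 2).

Definition measurement (u v : 'cV[R]_n) (A : 'M[R]_n) : 'M[R]_n :=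
  n%:R ^+ 2 *: (u *m u^T *m A *m v *m v^T).

Definition sampling M (u v : 'I_M -> 'cV[R]_n) (A : 'M[R]_n) : 'M[R]_n :=
  M%:R^-1 *: \sum_(i < M) measurement (u i) (v i) A.

Definition trace_norm_minimizer (S : 'M[R]_n -> 'M[R]_n) (H Hhat : 'M[R]_n) :
    Prop :=
  S Hhat = S H /\ forall A, S A = S H -> trace_norm Hhat <= trace_norm A.

End Measurements.

(* Main.v *)
Require Import Defs.
From HB Require Import structures.
From mathcomp Require Import all_boot all_order all_algebra.
From mathcomp Require Import all_classical all_reals all_analysis.
From mathcomp Require Import measurable_realfun complex ring lra zify.
Set Implicit Arguments.
Unset Strict Implicit.
Unset Printing Implicit Defensive.
Import Order.TTheory GRing.Theory Num.Theory.
Import numFieldNormedType.Exports.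
Local Open Scope classical_set_scope.
Local Open Scope ring_scope.

(* Nuclear norm minimization recovers H exactly, so the error bound on the
   Hessian is inherited from H. The constraint says that D = Hhat - H is
   annihilated by all functionals u_i^T D v_i, and minimality puts D in the cone
   |D|_1 <= 3 sqrt r |D|_F. On this cone the empirical norm
   p(X) = (1/M) sum_i n |u_i^T X v_i| cannot vanish: with high probability
   c |X|_F <= p(X) <= L |X|_F for all X of rank at most k r, and cutting the
   singular value decomposition of D into blocks of length k r shows that the
   first block dominates all others.

   For one X, both bounds fail with probability exponentially small in M: n u^T X v
   has bounded exponential moments (subgaussianity in u for fixed v, then
   exponential moments of n |X v|^2 / 8), hence upper bounds by Chernoff's method,
   and exp(-t) <= 1 - t^2/2 + t^4/8 turns second and fourth moments into lower
   bounds. A union bound over a net of n^O(n r) low-rank matrices needs only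
   M >= C n r log n. *)

(** * Frobenius inner product and orthogonal matrices *)

(** Conditioning of S is never studied: pairing S D with D turns the matrix equation S D = 0 into
    the scalar equations u_i^T D v_i = 0, and p measures how far these are from holding. The average
    in p is of absolute values, not of squares. For X of rank one, n u^T X v is a product of two
    nearly gaussian factors, so it has exponential tails only; its square has no exponential moment
    bounded independently of n, and the upper tail of a quadratic average would be too heavy for the
    union bound. A seminorm is also all that the block argument asks for, since it only adds up
    bounds on blocks.

    Recovery concerns uncountably many D at once, so its event is not visibly measurable. Rounding
    the samples to a grid gets around this: the favourable event is a Boolean combination of
    finitely many boxes and a null event, and the claim for every D is deduced pointwise on it. *)

Section Frobenius.
Context {R : realType}.

Definition mxdot m n (A B : 'M[R]_(m, n)) : R := \tr (A^T *m B).
Definition fnorm m n (A : 'M[R]_(m, n)) : R := Num.sqrt (mxdot A A).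

Lemma mxdotE m n (A B : 'M[R]_(m, n)) :
  mxdot A B = \sum_i \sum_j A i j * B i j.
Proof.
rewrite exchange_big; apply: eq_bigr => j _.
by rewrite !mxE; apply: eq_bigr => i _; rewrite mxE.
Qed.

Lemma mxdotC m n (A B : 'M[R]_(m, n)) : mxdot A B = mxdot B A.
Proof. by rewrite /mxdot -mxtrace_tr trmx_mul trmxK. Qed.

Lemma mxdotDl m n (A B C : 'M[R]_(m, n)) :
  mxdot (A + B) C = mxdot A C + mxdot B C.
Proof. by rewrite /mxdot linearD mulmxDl mxtraceD. Qed.

Lemma mxdotDr m n (A B C : 'M[R]_(m, n)) :
  mxdot A (B + C) = mxdot A B + mxdot A C.
Proof. by rewrite /mxdot mulmxDr mxtraceD. Qed.

Lemma mxdotZl m n a (A B : 'M[R]_(m, n)) : mxdot (a *: A) B = a * mxdot A B.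
Proof. by rewrite /mxdot linearZ -scalemxAl mxtraceZ. Qed.

Lemma mxdotZr m n a (A B : 'M[R]_(m, n)) : mxdot A (a *: B) = a * mxdot A B.
Proof. by rewrite mxdotC mxdotZl mxdotC. Qed.

Lemma mxdotNr m n (A B : 'M[R]_(m, n)) : mxdot A (- B) = - mxdot A B.
Proof. by rewrite -scaleN1r mxdotZr mulN1r. Qed.

Lemma mxdotNl m n (A B : 'M[R]_(m, n)) : mxdot (- A) B = - mxdot A B.
Proof. by rewrite mxdotC mxdotNr mxdotC. Qed.

Lemma mxdot0r m n (A : 'M[R]_(m, n)) : mxdot A 0 = 0.
Proof. by rewrite /mxdot mulmx0 mxtrace0. Qed.

Lemma mxdot_sumr m n (I : finType) (F : I -> 'M[R]_(m, n)) A :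
  mxdot A (\sum_i F i) = \sum_i mxdot A (F i).
Proof. by rewrite /mxdot mulmx_sumr raddf_sum. Qed.

Lemma mxdot_mull m n p (C : 'M[R]_(p, m)) (A : 'M[R]_(m, n)) B :
  mxdot (C *m A) B = mxdot A (C^T *m B).
Proof. by rewrite /mxdot trmx_mul mulmxA. Qed.

Lemma mxdot_mulr m n p (A : 'M[R]_(m, n)) (C : 'M[R]_(n, p)) B :
  mxdot (A *m C) B = mxdot A (B *m C^T).
Proof. by rewrite /mxdot trmx_mul -mulmxA mxtrace_mulC mulmxA. Qed.

Lemma mxdot_tr m n (A B : 'M[R]_(m, n)) : mxdot A^T B^T = mxdot A B.
Proof. by rewrite /mxdot trmxK mxtrace_mulC -mxtrace_tr trmx_mul trmxK. Qed.

Lemma mxdot_ge0 m n (A : 'M[R]_(m, n)) : 0 <= mxdot A A.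
Proof.
by rewrite mxdotE; do 2![apply: sumr_ge0 => ? _]; rewrite -expr2 sqr_ge0.
Qed.

Lemma mxdot_eq0 m n (A : 'M[R]_(m, n)) : mxdot A A = 0 -> A = 0.
Proof.
rewrite mxdotE => /eqP; rewrite psumr_eq0; last first.
  by move=> i _; apply: sumr_ge0 => ? _; rewrite -expr2 sqr_ge0.
move/allP=> A0; apply/matrixP => i j; rewrite mxE.
have := A0 i (mem_index_enum i); rewrite psumr_eq0; last first.
  by move=> ? _; rewrite -expr2 sqr_ge0.
by move/allP/(_ j (mem_index_enum j)); rewrite /= mulf_eq0 orbb => /eqP.
Qed.

Lemma mxdot_cols m n (A B : 'M[R]_(m, n)) :
  mxdot A B = \sum_j mxdot (col j A) (col j B).
Proof.
rewrite mxdotE exchange_big; apply: eq_bigr => j _.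
by rewrite mxdotE; apply: eq_bigr => i _; rewrite big_ord1 !mxE.
Qed.

Lemma fnorm_ge0 m n (A : 'M[R]_(m, n)) : 0 <= fnorm A.
Proof. exact: sqrtr_ge0. Qed.

Lemma fnorm_sqr m n (A : 'M[R]_(m, n)) : fnorm A ^+ 2 = mxdot A A.
Proof. by rewrite sqr_sqrtr ?mxdot_ge0. Qed.

Lemma fnorm_eq0 m n (A : 'M[R]_(m, n)) : fnorm A = 0 -> A = 0.
Proof. by move=> A0; apply: mxdot_eq0; rewrite -fnorm_sqr A0 expr0n. Qed.

Lemma fnorm0 m n : fnorm (0 : 'M[R]_(m, n)) = 0.
Proof. by rewrite /fnorm mxdot0r sqrtr0. Qed.

Lemma fnorm_gt0 m n (A : 'M[R]_(m, n)) : A != 0 -> 0 < fnorm A.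
Proof.
by rewrite lt_def fnorm_ge0 andbT; apply: contraNN => /eqP/fnorm_eq0->.
Qed.

Lemma fnormZ m n a (A : 'M[R]_(m, n)) : fnorm (a *: A) = `|a| * fnorm A.
Proof.
by rewrite /fnorm mxdotZl mxdotZr mulrA -expr2 sqrtrM ?sqr_ge0// sqrtr_sqr.
Qed.

Lemma mxdot_CS m n (A B : 'M[R]_(m, n)) : mxdot A B <= fnorm A * fnorm B.
Proof.
have [->|B0] := eqVneq B 0; first by rewrite mxdot0r fnorm0 mulr0.
have b0 := fnorm_gt0 B0.
have [->|A0] := eqVneq A 0; first by rewrite mxdotC mxdot0r fnorm0 mul0r.
have a0 := fnorm_gt0 A0.
have := mxdot_ge0 (fnorm B *: A + (- fnorm A) *: B).
rewrite !(mxdotDl, mxdotDr, mxdotZl, mxdotZr) -!fnorm_sqr (mxdotC B A) => h.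
have : 0 <= 2 * (fnorm A * fnorm B) * (fnorm A * fnorm B - mxdot A B) by nra.
by rewrite pmulr_rge0 ?subr_ge0// ?mulr_gt0.
Qed.

Lemma mxdot_CS_norm m n (A B : 'M[R]_(m, n)) : `|mxdot A B| <= fnorm A * fnorm B.
Proof.
rewrite ler_norml mxdot_CS andbT lerNl -mxdotNr.
by apply: (le_trans (mxdot_CS _ _)); rewrite -scaleN1r fnormZ normrN1 mul1r.
Qed.

Lemma entry_le_fnorm m n (A : 'M[R]_(m, n)) i j : `|A i j| <= fnorm A.
Proof.
rewrite -(ler_pXn2r (n := 2)) ?nnegrE ?fnorm_ge0// fnorm_sqr real_normK ?num_real//.
rewrite mxdotE (bigD1 i)//= (bigD1 j)//= -expr2 -addrA lerDl addr_ge0//.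
  by apply: sumr_ge0 => ? _; rewrite -expr2 sqr_ge0.
by do 2![apply: sumr_ge0 => ? _]; rewrite -expr2 sqr_ge0.
Qed.

Lemma fnormD m n (A B : 'M[R]_(m, n)) : fnorm (A + B) <= fnorm A + fnorm B.
Proof.
rewrite -(ler_pXn2r (n := 2)) ?nnegrE ?addr_ge0 ?fnorm_ge0// fnorm_sqr.
rewrite !(mxdotDl, mxdotDr) -!fnorm_sqr (mxdotC B A).
have := mxdot_CS A B; nra.
Qed.

Lemma mxdot_cV n (w x : 'cV[R]_n) : mxdot w x = \sum_i w i ord0 * x i ord0.
Proof. by rewrite mxdotE; apply: eq_bigr => i _; rewrite big_ord1. Qed.

Lemma fnorm_box n (w : 'cV[R]_n) (e : R) : (forall i, `|w i ord0| <= e) ->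
  fnorm w ^+ 2 <= n%:R * e ^+ 2.
Proof.
move=> we; rewrite fnorm_sqr mxdotE.
apply: (@le_trans _ _ (\sum_(i < n) e ^+ 2)); last first.
  by rewrite sumr_const card_ord mulr_natl.
apply: ler_sum => i _; rewrite big_ord1 -expr2 -real_normK ?num_real//.
by rewrite lerXn2r ?nnegrE// (le_trans _ (we i)).
Qed.

Lemma fnorm_square_le n (A : 'M[R]_n) (e : R) : 0 <= e ->
  (forall i j, `|A i j| <= e) -> fnorm A <= n%:R * e.
Proof.
move=> e0 Ae; rewrite -(ler_pXn2r (n := 2)) ?nnegrE ?mulr_ge0 ?fnorm_ge0//.
rewrite fnorm_sqr mxdotE; apply: (@le_trans _ _ (\sum_(i < n) \sum_(j < n) e ^+ 2)).
  apply: ler_sum => i _; apply: ler_sum => j _.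
  by rewrite -expr2 -real_normK ?num_real// lerXn2r ?nnegrE.
by rewrite !sumr_const card_ord -mulrnA -[leLHS]mulr_natl exprMn natrM -expr2.
Qed.

Lemma fnorm_mulmx m p q (A : 'M[R]_(m, p)) (B : 'M[R]_(p, q)) :
  fnorm (A *m B) <= fnorm A * fnorm B.
Proof.
rewrite -(ler_pXn2r (n := 2)) ?nnegrE ?mulr_ge0 ?fnorm_ge0// exprMn.
rewrite fnorm_sqr mxdotE.
have eA : fnorm A ^+ 2 = \sum_i fnorm (row i A)^T ^+ 2.
  rewrite fnorm_sqr mxdotE; apply: eq_bigr => i _.
  by rewrite fnorm_sqr mxdot_tr mxdotE big_ord1; apply: eq_bigr => j _; rewrite !mxE.
have eB : fnorm B ^+ 2 = \sum_j fnorm (col j B) ^+ 2.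
  by rewrite fnorm_sqr mxdot_cols; apply: eq_bigr => j _; rewrite fnorm_sqr.
rewrite eA eB mulr_suml; apply: ler_sum => i _.
rewrite mulr_sumr; apply: ler_sum => j _.
rewrite -expr2 -exprMn -real_normK ?num_real// lerXn2r ?nnegrE ?mulr_ge0 ?fnorm_ge0//.
have -> : (A *m B) i j = mxdot (row i A)^T (col j B).
  by rewrite mxE mxdotE; apply: eq_bigr => k _; rewrite big_ord1 !mxE.
exact: mxdot_CS_norm.
Qed.

Lemma mxdot_box n (X : 'M[R]_n) (u v : 'cV[R]_n) (e e' : R) :
  0 <= e -> 0 <= e' -> (forall i, `|u i ord0| <= e) -> (forall i, `|v i ord0| <= e') ->
  `|mxdot u (X *m v)| <= n%:R * (e * e') * fnorm X.
Proof.
move=> e0 e'0 ue ve; apply: (le_trans (mxdot_CS_norm _ _)).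
apply: (le_trans (ler_wpM2l (fnorm_ge0 _) (fnorm_mulmx _ _))).
rewrite mulrCA mulrC ler_wpM2r ?fnorm_ge0//.
rewrite -(ler_pXn2r (n := 2)) ?nnegrE ?mulr_ge0 ?fnorm_ge0// !exprMn.
have h1 := fnorm_box ue; have h2 := fnorm_box ve.
have := ler_pM (sqr_ge0 _) (sqr_ge0 _) h1 h2; lra.
Qed.

Lemma l2norm_fnorm n (v : 'cV[R]_n) : l2norm v = fnorm v.
Proof.
rewrite /l2norm /fnorm mxdotE; congr Num.sqrt.
by apply: eq_bigr => i _; rewrite big_ord1 expr2.
Qed.

Definition orthogonalmx n (Y : 'M[R]_n) := Y^T *m Y = 1%:M.

Lemma orthogonalmxC n (Y : 'M[R]_n) : orthogonalmx Y -> Y *m Y^T = 1%:M.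
Proof. exact: mulmx1C. Qed.

Lemma orthogonalmx_tr n (Y : 'M[R]_n) : orthogonalmx Y -> orthogonalmx Y^T.
Proof. by move=> oY; rewrite /orthogonalmx trmxK; apply: orthogonalmxC. Qed.

Lemma orthogonalmx_mul n (Y Z : 'M[R]_n) : orthogonalmx Y -> orthogonalmx Z -> orthogonalmx (Y *m Z).
Proof.
move=> oY oZ; rewrite /orthogonalmx trmx_mul mulmxA -(mulmxA Z^T).
by rewrite oY mulmx1.
Qed.

Lemma mxdot_ortho m n (Y : 'M[R]_m) (A B : 'M[R]_(m, n)) :
  orthogonalmx Y -> mxdot (Y *m A) (Y *m B) = mxdot A B.
Proof. by move=> oY; rewrite mxdot_mull mulmxA oY mul1mx. Qed.

Lemma mxdot_orthor m n (Y : 'M[R]_n) (A B : 'M[R]_(m, n)) :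
  orthogonalmx Y -> mxdot (A *m Y) (B *m Y) = mxdot A B.
Proof. by move=> oY; rewrite mxdot_mulr -mulmxA orthogonalmxC// mulmx1. Qed.

Lemma orthogonalmx_col n (Y : 'M[R]_n) j : orthogonalmx Y -> fnorm (col j Y) = 1.
Proof.
move=> oY; rewrite /fnorm (_ : mxdot _ _ = 1) ?sqrtr1//.
have /matrixP/(_ j j) : Y^T *m Y = 1%:M := oY.
rewrite [X in _ = X]mxE eqxx => e; rewrite -[RHS]e mxdotE !mxE.
by apply: eq_bigr => i _; rewrite big_ord1 !mxE.
Qed.

(* Householder reflection in the hyperplane orthogonal to [w - w']. *)
Lemma ortho_transitive n (w w' : 'cV[R]_n) : fnorm w = fnorm w' ->
  exists2 Q : 'M[R]_n, orthogonalmx Q & Q *m w = w'.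
Proof.
move=> ww'; have [->|nww] := eqVneq w w'.
  by exists 1%:M; rewrite /orthogonalmx ?trmx1 ?mul1mx.
pose z := w - w'; have z0 : z != 0 by rewrite subr_eq0.
have zz0 : mxdot z z != 0 by apply: contra_neq z0 => /mxdot_eq0.
have zzE : z^T *m z = (mxdot z z)%:M.
  by apply/matrixP => i j; rewrite !ord1 /mxdot /mxtrace big_ord1 [RHS]mxE mulr1n.
pose Q := 1%:M - (2 / mxdot z z) *: (z *m z^T).
have QT : Q^T = Q.
  by rewrite /Q linearB/= linearZ/= trmx_mul trmxK trmx1.
exists Q.
  rewrite /orthogonalmx QT /Q mulmxBl mul1mx mulmxBr mulmx1.
  rewrite -scalemxAl -scalemxAr mulmxA -(mulmxA z) zzE mul_mx_scalar.
  rewrite -scalemxAl !scalerA -!addrA -!opprD -!scalerBl -scalerDl.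
  rewrite [X in X *: _](_ : _ = 0) ?scale0r ?subr0//; field.
  exact: zz0.
have zw : mxdot z z = 2 * mxdot z w.
  have := congr1 (fun x => x ^+ 2) ww'; rewrite /= !fnorm_sqr => e.
  rewrite /z -scaleN1r !(mxdotDl, mxdotDr, mxdotZl, mxdotZr) (mxdotC w' w) -e; ring.
rewrite /Q mulmxBl mul1mx -scalemxAl -mulmxA.
have -> : z^T *m w = (mxdot z w)%:M.
  by apply/matrixP => i j; rewrite !ord1 /mxdot /mxtrace big_ord1 [RHS]mxE mulr1n.
rewrite mul_mx_scalar scalerA zw mulrAC.
have zw0 : mxdot z w != 0 by apply: contra_neq zz0 => h; rewrite zw h mulr0.
rewrite (_ : _ / _ = 1); last by field.
by rewrite scale1r /z opprB addrC subrK.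
Qed.

End Frobenius.

(** * Real spectral theorem *)

Section Spectral.
Context {R : realType}.

(** Take a complex eigenvalue a with row eigenvector x + i y. Symmetry gives <x A, y> = <x, y A>,
    which reads Im a (|x|^2 + |y|^2) = 0. So a is real, and whichever of x and y is nonzero is a
    real eigenvector. *)
Lemma sym_eigenvector n (A : 'M[R]_n) : (0 < n)%N -> A^T = A ->
  exists (l : R) (v : 'cV[R]_n), v != 0 /\ A *m v = l *: v.
Proof.
move=> n0 AT; pose i := real_complex R.
have [a /eigenvalueP[w wA w0]] := eigenvalue_closed (map_mx i A) n0.
pose x := map_mx (@complex.Re R) w; pose y := map_mx (@complex.Im R) w.
have xA : x *m A = complex.Re a *: x - complex.Im a *: y.
  apply/rowP => j; have /rowP/(_ j) := wA; rewrite !mxE.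
  move/(congr1 (@complex.Re R)); rewrite raddf_sum/=.
  case: (a) (w 0 j) => [a1 a2] [b1 b2] /= <-.
  by apply: eq_bigr => k _; rewrite !mxE /=; case: (w 0 k) => [c1 c2]/=; ring.
have yA : y *m A = complex.Re a *: y + complex.Im a *: x.
  apply/rowP => j; have /rowP/(_ j) := wA; rewrite !mxE.
  move/(congr1 (@complex.Im R)); rewrite raddf_sum/=.
  case: (a) (w 0 j) => [a1 a2] [b1 b2] /= <-.
  by apply: eq_bigr => k _; rewrite !mxE /=; case: (w 0 k) => [c1 c2]/=; ring.
have xy0 : mxdot x x + mxdot y y != 0.
  apply: contra_neq w0 => /eqP; rewrite paddr_eq0 ?mxdot_ge0// => /andP[].
  move=> /eqP/mxdot_eq0 x0 /eqP/mxdot_eq0 y0; apply/rowP => j.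
  have /rowP/(_ j) := x0; have /rowP/(_ j) := y0; rewrite !mxE.
  by case: (w 0 j) => ? ? /= -> ->.
have Ima : complex.Im a = 0.
  have : mxdot (x *m A) y = mxdot x (y *m A) by rewrite mxdot_mulr AT.
  rewrite xA yA -scaleN1r !(mxdotDl, mxdotDr, mxdotZl, mxdotZr) => h.
  have /eqP : complex.Im a * (mxdot x x + mxdot y y) = 0 by lra.
  by rewrite mulf_eq0 (negPf xy0) orbF => /eqP.
have [x0|x0] := eqVneq x 0.
  have y0 : y != 0.
    by apply: contra_neq xy0 => ->; rewrite x0 !mxdot0r addr0.
  exists (complex.Re a), y^T; split.
    by rewrite -(inj_eq trmx_inj) trmx0 trmxK.
  by rewrite -[A]AT -trmx_mul yA Ima scale0r addr0 linearZ.
exists (complex.Re a), x^T; split.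
  by rewrite -(inj_eq trmx_inj) trmx0 trmxK.
by rewrite -[A]AT -trmx_mul xA Ima scale0r subr0 linearZ.
Qed.

(** Deflation: conjugating by an orthogonal matrix that sends the first basis vector to a unit
    eigenvector makes the first column of [A] a multiple of that basis vector. Symmetry clears the
    first row, and the induction hypothesis applies to the remaining block. *)
Lemma sym_spectral n (A : 'M[R]_n) : A^T = A ->
  exists2 Y : 'M[R]_n, orthogonalmx Y & exists d, A = Y *m diag_mx d *m Y^T.
Proof.
elim: n A => [|n IHn] A AT.
  by exists 1%:M; [rewrite /orthogonalmx trmx1 mul1mx|exists 0; apply/matrixP => -[]].
have [l [v [v0 Av]]] := sym_eigenvector (ltn0Sn n) AT.
have nv0 : fnorm v != 0 by rewrite gt_eqF ?fnorm_gt0.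
have [Q oQ Qe] : exists2 Q : 'M[R]_(1 + n), orthogonalmx Q &
    Q *m delta_mx 0 0 = (fnorm v)^-1 *: v.
  apply: ortho_transitive; rewrite fnormZ ger0_norm ?invr_ge0 ?fnorm_ge0// mulVf//.
  rewrite /fnorm mxdotE (bigD1 0)//= big_ord1 !mxE eqxx mulr1 big1 ?addr0 ?sqrtr1//.
  by move=> i i0; rewrite big_ord1 mxE (negPf i0) mul0r.
pose B : 'M[R]_(1 + n) := Q^T *m A *m Q.
have BT : B^T = B by rewrite /B !trmx_mul trmxK AT mulmxA.
have Be : B *m delta_mx 0 0 = l *: (delta_mx 0 0 : 'cV_(1 + n)).
  rewrite /B -mulmxA Qe -scalemxAr -mulmxA Av -scalemxAr scalerA mulrC -scalerA.
  by rewrite scalemxAr -Qe mulmxA (_ : Q^T *m Q = 1%:M)// mul1mx.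
have Bl : lsubmx B = col_mx l%:M 0.
  have -> : lsubmx B = B *m (delta_mx 0 0 : 'cV_(1 + n)).
    rewrite -colE; apply/colP => i; rewrite [LHS]mxE [RHS]mxE; congr (B _ _).
    exact/val_inj.
  rewrite Be; apply/colP => i; rewrite !mxE.
  case: (splitP i) => j ij; rewrite !mxE.
    rewrite ord1 (_ : i == 0) ?mulr1//; apply/eqP/val_inj.
    by rewrite /= ij ord1.
  rewrite (_ : (i == 0) = false) ?mulr0//; apply/negP => /eqP i0.
  by move: ij; rewrite i0.
have BE : B = block_mx l%:M 0 0 (drsubmx B).
  have ul : ulsubmx B = l%:M.
    have -> : ulsubmx B = usubmx (lsubmx B) by apply/matrixP => i j; rewrite !mxE.
    by rewrite Bl col_mxKu.
  have dl : dlsubmx B = 0.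
    have -> : dlsubmx B = dsubmx (lsubmx B) by apply/matrixP => i j; rewrite !mxE.
    by rewrite Bl col_mxKd.
  have ur : ursubmx B = 0.
    by apply: trmx_inj; rewrite trmx0 trmx_ursub BT dl.
  by rewrite -{1}[B]submxK ul dl ur.
have DT : (drsubmx B)^T = drsubmx B by rewrite trmx_drsub BT.
have [Y oY [d Dd]] := IHn _ DT.
pose Z : 'M[R]_(1 + n) := block_mx 1%:M 0 0 Y.
have oZ : orthogonalmx Z.
  rewrite /orthogonalmx /Z tr_block_mx mulmx_block !trmx0 !mul0mx !mulmx0 !addr0 add0r.
  by rewrite trmx1 mul1mx (_ : Y^T *m Y = 1%:M)// -scalar_mx_block.
exists (Q *m Z); first exact: orthogonalmx_mul.
exists (row_mx l%:M d : 'rV_(1 + n)).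
have BZ : B = Z *m diag_mx (row_mx l%:M d : 'rV_(1 + n)) *m Z^T.
  rewrite {1}BE diag_mx_row /Z tr_block_mx !mulmx_block.
  rewrite !trmx0 !mul0mx !mulmx0 !addr0 !add0r trmx1 mul1mx mulmx1 mul0mx -Dd.
  congr block_mx; last by rewrite mul0mx.
  by apply/matrixP => i j; rewrite !ord1 !mxE.
have QZ : (A : 'M[R]_(1 + n)) =
    (Q *m Z) *m diag_mx (row_mx l%:M d : 'rV_(1 + n)) *m (Q *m Z)^T.
  rewrite trmx_mul !mulmxA -(mulmxA Q Z) -(mulmxA Q _ Z^T) -BZ /B !mulmxA.
  by rewrite orthogonalmxC// mul1mx -mulmxA orthogonalmxC// mulmx1.
exact: QZ.
Qed.

End Spectral.

(** * Trace norm *)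

Lemma rank_diag_mx (F : fieldType) n (d : 'rV[F]_n) :
  \rank (diag_mx d) = (\sum_j (d 0%R j != 0%R))%N.
Proof.
elim: n d => [|n IHn] d.
  by rewrite big_ord0 (flatmx0 (diag_mx d)) mxrank0.
suff rowE (a : 'rV[F]_1) (b : 'rV[F]_n) :
    \rank (diag_mx (row_mx a b)) = (\sum_j (row_mx a b 0%R j != 0%R))%N.
  by have := rowE (lsubmx (d : 'rV_(1 + n))) (rsubmx (d : 'rV_(1 + n)));
    rewrite hsubmxK.
rewrite big_split_ord/= big_ord1 row_mxEl diag_mx_row rank_diag_block_mx IHn.
congr (_ + _)%N; last by apply: eq_bigr => j _; rewrite row_mxEr.
rewrite rank_rV; congr (nat_of_bool (~~ _)).
apply/eqP/eqP => [/matrixP/(_ 0 0)|h]; first by rewrite !mxE.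
by apply/matrixP => i j; rewrite !ord1 !mxE.
Qed.

Section TraceNorm.
Context {R : realType}.

Lemma mxdot_diag n (d : 'rV[R]_n) (x : 'cV[R]_n) :
  mxdot x (diag_mx d *m x) = \sum_j d 0 j * x j 0 ^+ 2.
Proof.
rewrite mxdotE; apply: eq_bigr => j _.
by rewrite big_ord1 mul_diag_mx !mxE expr2; ring.
Qed.

Lemma psdmx_mxdot n (B : 'M[R]_n) :
  psdmx B <-> B^T = B /\ forall v : 'cV[R]_n, 0 <= mxdot v (B *m v).
Proof.
have E (v : 'cV[R]_n) : (v^T *m B *m v) ord0 ord0 = mxdot v (B *m v).
  by rewrite /mxdot mulmxA /mxtrace big_ord1.
by split=> -[BT B0]; split=> // v; have := B0 v; rewrite E.
Qed.

Lemma psd_spectral n (B : 'M[R]_n) : psdmx B ->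
  exists2 Y : 'M[R]_n, orthogonalmx Y &
  exists2 d : 'rV[R]_n, (forall j, 0 <= d 0 j) & B = Y *m diag_mx d *m Y^T.
Proof.
move=> /psdmx_mxdot[BT B0]; have [Y oY [d Bd]] := sym_spectral BT.
exists Y => //; exists d => // j.
have := B0 (Y *m delta_mx j 0).
rewrite Bd -!mulmxA (mulmxA Y^T) (_ : Y^T *m Y = 1%:M)// mul1mx mxdot_ortho//.
rewrite mxdot_diag (bigD1 j)//= big1 ?addr0; first by rewrite mxE !eqxx expr1n mulr1.
by move=> i ij; rewrite mxE (negPf ij) expr0n mulr0.
Qed.

(** Exhibiting one square root, by taking roots of the eigenvalues of A^T A, is what gives the
    [xget] in [absmx] its meaning. *)
Lemma absmxP n (A : 'M[R]_n) :
  psdmx (absmx A) /\ absmx A *m absmx A = A^T *m A.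
Proof.
suff [B BP] : exists B : 'M[R]_n, psdmx B /\ B *m B = A^T *m A.
  by rewrite /absmx; case: xgetP => [C -> []//|/(_ B)].
have pA : psdmx (A^T *m A).
  apply/psdmx_mxdot; split; first by rewrite trmx_mul trmxK.
  by move=> v; rewrite -mulmxA -mxdot_mull mxdot_ge0.
have [Y oY [d d0 Ad]] := psd_spectral pA.
pose e : 'rV[R]_n := \row_j Num.sqrt (d 0 j).
exists (Y *m diag_mx e *m Y^T); split.
  apply/psdmx_mxdot; split.
    by rewrite !trmx_mul trmxK tr_diag_mx mulmxA.
  move=> v; rewrite -!mulmxA -{1}[v]mul1mx -(orthogonalmxC oY) -mulmxA mxdot_ortho//.
  rewrite mxdot_diag; apply: sumr_ge0 => j _.
  by rewrite mulr_ge0 ?sqr_ge0// mxE sqrtr_ge0.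
rewrite Ad -!mulmxA (mulmxA Y^T Y) (_ : Y^T *m Y = 1%:M)// mul1mx.
rewrite (mulmxA (diag_mx e)); congr (_ *m (_ *m _)).
apply/matrixP => i j; rewrite mul_diag_mx !mxE.
by have [->|] := eqVneq i j; rewrite ?mulr0//= !mulr1n -expr2 sqr_sqrtr.
Qed.

(* The columns of [A *m Y] are the left singular vectors scaled by the
   singular values [d 0 j]. *)
Lemma half_svd n (A : 'M[R]_n) :
  exists2 Y : 'M[R]_n, orthogonalmx Y & exists d : 'rV[R]_n,
  [/\ forall j, 0 <= d 0 j,
      (A *m Y)^T *m (A *m Y) = diag_mx (\row_j d 0 j ^+ 2),
      forall j, fnorm (col j (A *m Y)) = d 0 j &
      trace_norm A = \sum_j d 0 j].
Proof.
have [pB BB] := absmxP A; have [Y oY [d d0 Bd]] := psd_spectral pB.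
have AY : (A *m Y)^T *m (A *m Y) = diag_mx (\row_j d 0 j ^+ 2).
  rewrite trmx_mul -mulmxA (mulmxA A^T) -BB Bd -!mulmxA.
  rewrite (mulmxA Y^T Y) (_ : Y^T *m Y = 1%:M)// mul1mx mulmx1.
  rewrite (mulmxA Y^T Y) (_ : Y^T *m Y = 1%:M)// mul1mx.
  apply/matrixP => i j; rewrite mul_diag_mx !mxE.
  by have [->|] := eqVneq i j; rewrite ?mulr0//= !mulr1n -expr2.
exists Y => //; exists d; split => //.
- move=> j; have := congr1 (fun M : 'M[R]_n => M j j) AY.
  rewrite ![in RHS]mxE eqxx mulr1n => e.
  rewrite /fnorm (_ : mxdot _ _ = d 0 j ^+ 2) ?sqrtr_sqr ?ger0_norm//.
  rewrite -e mxdotE [RHS]mxE; apply: eq_bigr => i _.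
  by rewrite big_ord1 ![col _ _ _ _]mxE [in RHS]mxE.
- rewrite /trace_norm Bd mxtrace_mulC mulmxA (_ : Y^T *m Y = 1%:M)// mul1mx.
  by rewrite mxtrace_diag.
Qed.

(** The unit ball of the operator norm, phrased pointwise to avoid the supremum in [opnorm]. The
    next lemmas show that the trace norm is its dual norm. *)
Definition contraction n (W : 'M[R]_n) :=
  forall x : 'cV[R]_n, fnorm (W *m x) <= fnorm x.

(** |W^T x|^2 = <W W^T x, x> <= |W^T x| |x|, then cancel one factor. *)
Lemma contraction_tr n (W : 'M[R]_n) : contraction W -> contraction W^T.
Proof.
move=> cW x; have := mxdot_CS (W *m (W^T *m x)) x.
rewrite mxdot_mull -fnorm_sqr => h.
have h2 := cW (W^T *m x).
have := fnorm_ge0 x; have := fnorm_ge0 (W^T *m x) => a0 x0.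
have {}h : fnorm (W^T *m x) ^+ 2 <= fnorm (W^T *m x) * fnorm x.
  by apply: (le_trans h); rewrite ler_wpM2r.
have [->//|an0] := eqVneq (fnorm (W^T *m x)) 0.
by rewrite expr2 ler_pM2l// lt_def an0 in h.
Qed.

(** In a basis y_j of right singular vectors the pairing is the sum of <W y_j, A y_j>, and each term
    is at most the singular value |A y_j|. *)
Lemma trace_norm_ge n (W A : 'M[R]_n) : contraction W -> mxdot W A <= trace_norm A.
Proof.
move=> cW; have [Y oY [d [d0 _ dn ->]]] := half_svd A.
rewrite -(mxdot_orthor _ _ oY) mxdot_cols; apply: ler_sum => j _.
apply: (le_trans (mxdot_CS _ _)).
by rewrite dn ler_piMl// colE -mulmxA -colE (le_trans (cW _))// orthogonalmx_col.
Qed.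

(** The witness is the partial isometry of the polar decomposition. The convention 0^-1 = 0 makes it
    vanish on the kernel of [A]. *)
Lemma trace_norm_attained n (A : 'M[R]_n) :
  exists2 W, contraction W & trace_norm A = mxdot W A.
Proof.
have [Y oY [d [d0 ZZ _ ->]]] := half_svd A.
pose e : 'rV[R]_n := \row_j (d 0 j)^-1.
exists (A *m Y *m diag_mx e *m Y^T).
  move=> x; rewrite -(ler_pXn2r (n := 2)) ?nnegrE ?fnorm_ge0//.
  rewrite !fnorm_sqr -mulmxA; set z := Y^T *m x.
  have -> : mxdot x x = mxdot z z.
    by rewrite /z mxdot_ortho//; apply: orthogonalmx_tr.
  rewrite -(mulmxA _ _ z) mxdot_mull mulmxA ZZ mxdot_mull tr_diag_mx.
  rewrite mulmxA !mulmx_diag mulmxA mulmx_diag mxdot_diag mxdotE.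
  apply: ler_sum => j _; rewrite big_ord1 !mxE -expr2 ler_piMl ?sqr_ge0//.
  have [->|dj] := eqVneq (d 0 j) 0; first by rewrite invr0 !mul0r ler01.
  by rewrite (_ : _ / _ = 1)//; field.
rewrite mxdot_mulr trmxK /mxdot trmx_mul tr_diag_mx -mulmxA ZZ mulmx_diag mxtrace_diag; apply: eq_bigr => j _.
rewrite !mxE; have [->|dj] := eqVneq (d 0 j) 0; first by rewrite expr0n mulr0.
by field.
Qed.

Lemma trace_norm_ge0 n (A : 'M[R]_n) : 0 <= trace_norm A.
Proof.
have [Y _ [d [d0 _ _ ->]]] := half_svd A; exact: sumr_ge0.
Qed.

Lemma trace_norm_eq0 n (A : 'M[R]_n) : trace_norm A = 0 -> A = 0.
Proof.
have [Y oY [d [d0 _ dn ->]]] := half_svd A => /(psumr_eq0P (fun i _ => d0 i)) d00.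
suff Z0 : A *m Y = 0 by rewrite -[A]mulmx1 -(orthogonalmxC oY) mulmxA Z0 mul0mx.
apply/matrixP => i j; have := fnorm_eq0 (etrans (dn j) (d00 j isT)).
by move/matrixP/(_ i 0); rewrite !mxE.
Qed.

(* Testing [H + D] against the contraction sgn H + Q V Q, where Q projects onto
   the kernel of [H] and V is the polar factor of Q D Q, bounds the trace norm
   of Q D Q; the rest of [D] has rank at most 2 rank H. *)
Lemma trace_norm_cone n (H D : 'M[R]_n) : H^T = H ->
  trace_norm (H + D) <= trace_norm H ->
  trace_norm D <= 3 * Num.sqrt (\rank H)%:R * fnorm D.
Proof.
move=> HT HD; have [Y oY [h Hh]] := sym_spectral HT.
have YY : Y^T *m Y = 1%:M := oY.
(* In the eigenbasis of [H]: [P] projects onto the range, [Wh] is sgn [H], and [Q] projects onto the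
   kernel. *)
pose e : 'rV[R]_n := \row_j (h 0 j != 0)%:R.
have [P PE] : exists P, P = Y *m diag_mx e *m Y^T by eexists.
have [Wh WE] : exists Wh, Wh = Y *m diag_mx (\row_j Num.sg (h 0 j)) *m Y^T.
  by eexists.
have [Q QE] : exists Q, Q = 1%:M - P by eexists.
have dE (a b : 'rV[R]_n) : (Y *m diag_mx a *m Y^T) *m (Y *m diag_mx b *m Y^T) =
    Y *m diag_mx (\row_j (a 0 j * b 0 j)) *m Y^T.
  by rewrite -!mulmxA (mulmxA Y^T Y) YY mul1mx (mulmxA (diag_mx a)) mulmx_diag.
have PT : P^T = P by rewrite PE !trmx_mul trmxK tr_diag_mx mulmxA.
have QT : Q^T = Q by rewrite QE linearB/= trmx1 PT.
have PP : P *m P = P.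
  rewrite PE dE; congr (_ *m diag_mx _ *m _); apply/rowP => j; rewrite !mxE.
  by case: (h 0 j == 0); rewrite ?mulr0 ?mulr1.
have HP : H *m P = H.
  rewrite Hh PE dE; congr (_ *m diag_mx _ *m _); apply/rowP => j; rewrite !mxE.
  by have [->|] := eqVneq (h 0 j) 0; rewrite ?mulr0 ?mulr1.
have WP : Wh *m P = Wh.
  rewrite PE WE dE; congr (_ *m diag_mx _ *m _); apply/rowP => j; rewrite !mxE.
  by have [->|] := eqVneq (h 0 j) 0; rewrite ?sgr0 ?mulr0 ?mulr1.
have PW : P *m Wh = Wh.
  rewrite PE WE dE; congr (_ *m diag_mx _ *m _); apply/rowP => j; rewrite !mxE.
  by have [->|] := eqVneq (h 0 j) 0; rewrite ?sgr0 ?mulr0 ?mul1r.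
have QP : Q *m P = 0 by rewrite QE mulmxBl mul1mx PP subrr.
have PQ : P *m Q = 0 by rewrite QE mulmxBr mulmx1 PP subrr.
have QQ : Q *m Q = Q by rewrite {1}QE mulmxBl mul1mx PQ subr0.
have HQ : H *m Q = 0 by rewrite -HP -mulmxA PQ mulmx0.
have r_e : (\rank H)%:R = \sum_j e 0 j :> R.
  rewrite Hh mxrankMfree ?row_free_unit ?unitmx_tr; last first.
    by case: (mulmx1_unit YY).
  rewrite eqmxMfull ?row_full_unit; last by case: (mulmx1_unit YY).
  by rewrite rank_diag_mx natr_sum; apply: eq_bigr => j _; rewrite mxE.
(* The square of the left side is the sum of |W y_j|^2 over the rank [H] eigenvectors with nonzero
   eigenvalue. *)
have cP (W : 'M[R]_n) : contraction W -> fnorm (W *m P) <= Num.sqrt (\rank H)%:R.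
  move=> cW; rewrite PE mulmxA /fnorm ler_sqrt ?ler0n// mxdot_orthor//; last first.
    exact: orthogonalmx_tr.
  rewrite mxdot_cols r_e; apply: ler_sum => j _.
  have -> : col j (W *m (Y *m diag_mx e)) = e 0 j *: (W *m col j Y).
    by rewrite !colE !scalemxAr -!mulmxA; congr (_ *m (_ *m _));
      apply/colP => i; rewrite mul_diag_mx !mxE; have [->|] := eqVneq i j;
      rewrite ?mulr0.
  rewrite mxdotZl mxdotZr -fnorm_sqr.
  have h1 : fnorm (W *m col j Y) <= 1.
    by rewrite (le_trans (cW _))// orthogonalmx_col.
  have h0 := fnorm_ge0 (W *m col j Y).
  rewrite mxE; case: (h 0 j == 0); rewrite ?mul0r ?mul1r ?expr_le1 ?lexx//.
have cWh : contraction Wh.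
  move=> x; rewrite -(ler_pXn2r (n := 2)) ?nnegrE ?fnorm_ge0// !fnorm_sqr.
  rewrite WE -!mulmxA mxdot_ortho//.
  have oYT := orthogonalmx_tr oY; rewrite -[leRHS](mxdot_ortho _ _ oYT).
  move: (Y^T *m x) => y.
  rewrite !mxdotE; apply: ler_sum => j _; rewrite !big_ord1 mul_diag_mx !mxE.
  rewrite -!expr2 exprMn sqr_sg.
  by rewrite ler_piMl ?sqr_ge0// lern1 leq_b1.
(* An optimal contraction has diagonal entries of absolute value at most 1 in the eigenbasis, so sgn
   [H] does at least as well. *)
have tH : trace_norm H <= mxdot Wh H.
  have [W cW ->] := trace_norm_attained H.
  rewrite -(mxdot_orthor W _ oY) -(mxdot_orthor Wh _ oY) !mxdot_cols.
  apply: ler_sum => j _.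
  have Hj : col j (H *m Y) = h 0 j *: col j Y.
    rewrite Hh -mulmxA YY mulmx1 !colE scalemxAr -!mulmxA; congr (_ *m _).
    by apply/colP => i; rewrite mul_diag_mx !mxE; have [->|] := eqVneq i j;
      rewrite ?mulr0.
  have Wj : col j (Wh *m Y) = Num.sg (h 0 j) *: col j Y.
    rewrite WE -mulmxA YY mulmx1 !colE scalemxAr -!mulmxA; congr (_ *m _).
    by apply/colP => i; rewrite mul_diag_mx !mxE; have [->|] := eqVneq i j;
      rewrite ?mulr0.
  rewrite Hj Wj !mxdotZr mxdotZl -fnorm_sqr orthogonalmx_col// expr1n mulr1.
  rewrite [leRHS]mulrC -normrEsg; apply: le_trans (ler_norm _) _.
  rewrite normrM ler_piMr//; apply: le_trans (mxdot_CS_norm _ _) _.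
  rewrite (orthogonalmx_col _ oY) mulr1 colE -mulmxA -colE.
  by rewrite (le_trans (cW _))// orthogonalmx_col.
have [B BE] : exists B, B = Q *m D *m Q by eexists.
have [V cV VB] := trace_norm_attained B.
have decomp (x : 'cV[R]_n) : fnorm x ^+ 2 = fnorm (P *m x) ^+ 2 + fnorm (Q *m x) ^+ 2.
  rewrite !fnorm_sqr !mxdot_mull PT QT !mulmxA PP QQ -mxdotDr -mulmxDl.
  by rewrite QE addrC subrK mul1mx.
(* The two summands act on the orthogonal ranges of [P] and [Q], so Pythagoras reduces the claim to
   each of them. *)
have cW : contraction (Wh + Q *m V *m Q).
  move=> x; rewrite -(ler_pXn2r (n := 2)) ?nnegrE ?fnorm_ge0//.
  have e1 : P *m (Wh + Q *m V *m Q) = Wh *m P.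
    by rewrite mulmxDr PW WP !mulmxA PQ !mul0mx addr0.
  have e2 : Q *m (Wh + Q *m V *m Q) = Q *m V *m Q.
    by rewrite mulmxDr -{1}PW !mulmxA QP QQ !mul0mx add0r.
  rewrite [leRHS]decomp [leLHS]decomp !(mulmxA _ (Wh + _)) e1 e2 -!mulmxA.
  apply: lerD.
    by rewrite ler_pXn2r ?nnegrE ?fnorm_ge0 ?cWh.
  rewrite ler_pXn2r ?nnegrE ?fnorm_ge0//; apply: le_trans (cV _).
  rewrite -(ler_pXn2r (n := 2)) ?nnegrE ?fnorm_ge0//.
  by rewrite [leRHS]decomp lerDr sqr_ge0.
(* The pairing with H + D equals <Wh, H> + <Wh, D> + |B|_1 and is at most |H|_1 <= <Wh, H>. Hence
   |B|_1 <= - <Wh, D>. *)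
have Bd : trace_norm B <= Num.sqrt (\rank H)%:R * fnorm D.
  have := le_trans (trace_norm_ge (H + D) cW) HD.
  rewrite mxdotDl !mxdotDr [mxdot (Q *m V *m Q) H]mxdot_mulr QT HQ mxdot0r.
  rewrite mxdot_mulr QT mxdot_mull QT mulmxA -BE -VB.
  have := mxdot_CS_norm Wh D; have := cP _ cWh; rewrite WP.
  rewrite ler_norml => k /andP[k1 _] k2.
  have k3 : fnorm Wh * fnorm D <= Num.sqrt (\rank H)%:R * fnorm D.
    by rewrite ler_wpM2r ?fnorm_ge0.
  lra.
have [W cW' WD] := trace_norm_attained D.
(* Each of the three pieces costs one sqrt (rank H) |D|_F, whence the factor 3. *)
have DE : D = P *m D + Q *m (D *m P) + B.
  have PQ1 : P + Q = 1%:M by rewrite QE addrC subrK.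
  by rewrite BE -addrA -[Q *m D *m Q]mulmxA -!mulmxDr PQ1 mulmx1 -mulmxDl PQ1 mul1mx.
rewrite WD [X in mxdot W X]DE !mxdotDr.
have t1 : mxdot W (P *m D) <= Num.sqrt (\rank H)%:R * fnorm D.
  rewrite -[X in mxdot _ (X *m D)]PT -mxdot_mull.
  apply: (le_trans (mxdot_CS _ _)); rewrite ler_wpM2r ?fnorm_ge0//.
  have := cP _ (contraction_tr cW').
  by rewrite /fnorm -(mxdot_tr (P *m W)) trmx_mul PT.
have t2 : mxdot W (Q *m (D *m P)) <= Num.sqrt (\rank H)%:R * fnorm D.
  rewrite -[X in mxdot _ (X *m _)]QT -mxdot_mull -[X in mxdot _ (_ *m X)]PT.
  rewrite -mxdot_mulr.
  apply: (le_trans (mxdot_CS _ _)); rewrite ler_wpM2r ?fnorm_ge0//.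
  rewrite -mulmxA; apply: le_trans (cP _ cW').
  rewrite -(ler_pXn2r (n := 2)) ?nnegrE ?fnorm_ge0// !fnorm_sqr !mxdot_cols.
  apply: ler_sum => j _; rewrite !colE -!mulmxA -!fnorm_sqr.
  by rewrite [leRHS]decomp lerDr sqr_ge0.
have t3 := le_trans (trace_norm_ge B cW') Bd.
lra.
Qed.

End TraceNorm.

(** * Block decomposition of singular values *)

Section Blocks.
Context {R : realType}.

(** Repeatedly taking a largest remaining value yields the blocks without sorting the singular
    values. *)
Lemma top_subset n (d : 'I_n -> R) (J : {set 'I_n}) K : (K <= #|J|)%N ->
  exists J1 : {set 'I_n}, [/\ J1 \subset J, #|J1| = K &
    forall i j, i \in J1 -> j \in J :\: J1 -> d j <= d i].
Proof.
elim: K => [|K IHK] KJ.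
  by exists finset.set0; rewrite finset.sub0set finset.cards0; split=> // i j; rewrite finset.in_set0.
have [J1 [J1J J1K J1d]] := IHK (ltnW KJ).
have [i0 i0J] : exists i0, i0 \in J :\: J1.
  apply/finset.set0Pn; rewrite -card_gt0 cardsD (finset.setIidPr J1J) J1K subn_gt0//.
have [i iJ imax] : exists2 i, i \in J :\: J1 & forall j, j \in J :\: J1 -> d j <= d i.
  by have [i iJ imax] := @arg_maxP _ _ _ i0 (mem (J :\: J1)) d i0J; exists i.
exists (i |: J1); split.
- rewrite finset.subUset J1J finset.sub1set andbT; by move: iJ; rewrite inE => /andP[].
- by rewrite cardsU1 J1K; move: iJ; rewrite inE => /andP[-> _].
- move=> k j; rewrite in_setU1 => /orP[/eqP->|kJ1] jJ.
    apply: imax; move: jJ; rewrite !inE negb_or -andbA => /and3P[_ -> ->]//.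
  apply: J1d => //; by move: jJ; rewrite !inE negb_or -andbA => /and3P[_ -> ->].
Qed.

Lemma diag_mx_cols m n (A : 'M[R]_(m, n)) (e : 'rV[R]_n) j :
  col j (A *m diag_mx e) = e 0 j *: col j A.
Proof. by apply/colP => i; rewrite mul_mx_diag !mxE mulrC. Qed.

(* Cut the singular values of [D] into decreasing blocks of length [K]. Each
   singular value is at most the mean of the preceding block, so the blocks
   beyond the first contribute at most [trace_norm D / sqrt K] in Frobenius
   norm, which the cone condition makes negligible against the first block. *)
Lemma block_recovery n K (p : 'M[R]_n -> R) (c L s : R) (D : 'M[R]_n) :
  (forall X Y, p (X + Y) <= p X + p Y) ->
  (forall a X, p (a *: X) = `|a| * p X) ->
  (forall A B : 'M[R]_(n, K),
    (forall i j, `|A i j| <= 1) -> (forall i j, `|B i j| <= 1) ->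
    fnorm (A *m B^T) = 1 -> c <= p (A *m B^T) <= L) ->
  (0 < K)%N -> 0 < c -> 0 <= L ->
  trace_norm D <= s * fnorm D -> s * (c + L) < c * Num.sqrt K%:R ->
  p D = 0 -> D = 0.
Proof.
move=> pD pZ UP K0 c0 L0 Ds sK pD0.
have [Y oY [d [d0 _ dn dT]]] := half_svd D.
have [Z ZE] : exists Z, Z = D *m Y by eexists.
rewrite -ZE in dn.
pose e (J : {set 'I_n}) : 'rV[R]_n := \row_j (j \in J)%:R.
pose X J := Z *m diag_mx (e J) *m Y^T.
have XT : X [set: 'I_n]%SET = D.
  rewrite /X (_ : diag_mx _ = 1%:M) ?mulmx1 ?ZE -?mulmxA ?orthogonalmxC ?mulmx1//.
  by apply/matrixP => i j; rewrite !mxE finset.in_setT.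
have XU (J J1 : {set 'I_n}) : J1 \subset J -> X J = X J1 + X (J :\: J1).
  move=> J1J; rewrite /X -mulmxDl -mulmxDr; congr (_ *m _ *m _).
  apply/matrixP => i j; rewrite !mxE finset.in_setD -mulrnDl; congr (_ *+ _).
  by have [/(fintype.subsetP J1J)->|] := boolP (i \in J1); rewrite ?addr0 ?add0r.
have Xn (J : {set 'I_n}) : fnorm (X J) ^+ 2 = \sum_(j in J) d 0 j ^+ 2.
  rewrite fnorm_sqr /X mxdot_orthor; last exact: orthogonalmx_tr.
  rewrite mxdot_cols [RHS]big_mkcond; apply: eq_bigr => j _.
  rewrite diag_mx_cols mxdotZl mxdotZr -fnorm_sqr dn !mxE.
  by case: (j \in J); rewrite ?mul0r ?mul1r.
have Yle i j : `|Y i j| <= 1.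
  by have := entry_le_fnorm (col j Y) i 0; rewrite orthogonalmx_col// mxE.
have p0 : p 0 = 0 by rewrite -(scale0r 0) pZ normr0 mul0r.
(* [X J] is the part of [D] on the right singular vectors indexed by [J]. Once normalized, it
   factors through K columns, taken from [Z] and [Y], with entries at most 1, so the hypothesis on
   products applies. *)
have low (J : {set 'I_n}) : (#|J| <= K)%N ->
    c * fnorm (X J) <= p (X J) <= L * fnorm (X J).
  move=> JK; have [X0|X0] := eqVneq (X J) 0.
    by rewrite X0 p0 fnorm0 !mulr0 lexx.
  have f0 := fnorm_gt0 X0; set f := fnorm (X J) in f0 *.
  have [j0 j0J] : exists j0, j0 \in J.
    apply/finset.set0Pn; apply: contra_neq X0 => J0; apply: fnorm_eq0.
    by apply/eqP; rewrite -sqrf_eq0 Xn J0 finset.big_set0.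
  (* Past the end of [J], [nth] returns [j0]; the indicator in [A] removes these columns from the
     product. *)
  pose g t := nth j0 (enum J) t.
  pose A : 'M[R]_(n, K) := \matrix_(i, t) ((t < #|J|)%N%:R * (f^-1 * Z i (g t))).
  pose B : 'M[R]_(n, K) := \matrix_(i, t) Y i (g t).
  have gJ t : (t < #|J|)%N -> g t \in J.
    by move=> tJ; rewrite -mem_enum mem_nth// -cardE.
  have AB : A *m B^T = f^-1 *: X J.
    apply/matrixP => i k; rewrite !mxE.
    transitivity (\sum_(j in J) f^-1 * Z i j * Y k j); last first.
      rewrite mulr_sumr big_mkcond; apply: eq_bigr => j _.
      rewrite mul_mx_diag !mxE.
      by case: (j \in J); rewrite ?mulr1 ?mulr0 ?mul0r ?mulr0// mulrA.
    rewrite -[RHS]big_enum/= [RHS](big_nth j0) -cardE big_mkord.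
    rewrite (big_ord_widen_cond K xpredT (fun t => f^-1 * Z i (g t) * Y k (g t)))//.
    rewrite [RHS]big_mkcond; apply: eq_bigr => t _.
    by rewrite !mxE; case: (t < #|J|)%N; rewrite ?mul1r ?mul0r.
  have fi : 0 <= f^-1 by rewrite invr_ge0 ltW.
  have := UP A B; rewrite AB pZ fnormZ (ger0_norm fi) -/f mulVf ?gt_eqF//.
  rewrite ler_pdivlMl// ler_pdivrMl// mulrC (mulrC L); apply => //.
    move=> i t; rewrite mxE; case: ltnP => tJ; last by rewrite mul0r normr0.
    rewrite mul1r normrM (ger0_norm fi) ler_pdivrMl// mulr1.
    have := entry_le_fnorm (col (g t) Z) i 0; rewrite mxE dn => h.
    apply: (le_trans h).
    rewrite -(ler_pXn2r (n := 2)) ?nnegrE ?fnorm_ge0// Xn.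
    rewrite (bigD1 (g t)) ?gJ//= lerDl; apply: sumr_ge0 => *; exact: sqr_ge0.
  by move=> i t; rewrite mxE.
have sK0 : 0 < Num.sqrt K%:R :> R by rewrite sqrtr_gt0 ltr0n.
have sKK : Num.sqrt K%:R ^+ 2 = K%:R :> R by rewrite sqr_sqrtr ?ler0n.
have sKd (x : R) : Num.sqrt K%:R * (x / K%:R) = x / Num.sqrt K%:R.
  by rewrite -[in x / _]sKK; field; rewrite gt_eqF.
(* Stated for a general [q] so as to serve both [p] and [fnorm]. The bound [m] on the singular
   values in [J] is, in use, the mean of the preceding block: the leading block costs sqrt K times
   [m], and its own mean is the [m] of the recursive call. *)
have blk (q : 'M[R]_n -> R) (L' : R) : 0 <= L' ->
    (forall X Y, q (X + Y) <= q X + q Y) ->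
    (forall J : {set 'I_n}, (#|J| <= K)%N -> q (X J) <= L' * fnorm (X J)) ->
    forall (J : {set 'I_n}) m, 0 <= m -> (forall j, j \in J -> d 0 j <= m) ->
    q (X J) <= L' * (Num.sqrt K%:R * m + (\sum_(j in J) d 0 j) / Num.sqrt K%:R).
  move=> L'0 qD qlow J; have [k] := ubnP #|J|; elim: k J => // k IHk J Jk m m0 Jm.
  have small (J1 : {set 'I_n}) : (#|J1| <= K)%N -> J1 \subset J ->
      q (X J1) <= L' * (Num.sqrt K%:R * m).
    move=> J1K J1J; apply: (le_trans (qlow _ J1K)); rewrite ler_wpM2l//.
    have sm0 : 0 <= Num.sqrt K%:R * m by rewrite mulr_ge0// ltW.
    rewrite -(ler_pXn2r (n := 2)) ?nnegrE ?fnorm_ge0// Xn.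
    apply: (@le_trans _ _ (\sum_(j in J1) m ^+ 2)).
      apply: ler_sum => j jJ; rewrite ler_pXn2r ?nnegrE//.
      by apply: Jm; apply: (fintype.subsetP J1J).
    rewrite sumr_const exprMn sKK -[leLHS]mulr_natl ler_wpM2r ?sqr_ge0//.
    by rewrite ler_nat.
  have [JK|KJ] := leqP #|J| K.
    apply: (le_trans (small _ JK (subxx _))); rewrite ler_wpM2l// lerDl.
    by rewrite divr_ge0 ?sumr_ge0 ?ltW.
  have [J1 [J1J J1K J1d]] := top_subset (d 0) (ltnW KJ).
  rewrite (XU _ _ J1J); apply: (le_trans (qD _ _)).
  have /IHk : (#|J :\: J1| < k)%N.
    rewrite cardsD (finset.setIidPr J1J) J1K; move: Jk KJ K0; clear; lia.
  move=> /(_ ((\sum_(j in J1) d 0 j) / K%:R)) h.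
  have {}h : q (X (J :\: J1)) <= L' * (Num.sqrt K%:R * ((\sum_(j in J1) d 0 j) / K%:R) +
      (\sum_(j in J :\: J1) d 0 j) / Num.sqrt K%:R).
    apply: h; first by rewrite divr_ge0 ?sumr_ge0.
    move=> j jJ; rewrite ler_pdivlMr ?ltr0n// mulr_natr -J1K -sumr_const.
    by apply: ler_sum => i iJ; apply: J1d.
  apply: (le_trans (lerD (small _ _ J1J) h)); first by rewrite J1K.
  rewrite -mulrDr ler_wpM2l// lerD2l [X in _ <= X / _](@big_setID _ _ _ _ J J1)/= (finset.setIidPr J1J) mulrDl lerD2r.
  by rewrite sKd.
have [nK|Kn] := leqP n K.
  have := low [set: 'I_n]%SET; rewrite finset.cardsT card_ord XT pD0 => /(_ nK) /andP[h _].
  by apply: fnorm_eq0; apply/eqP; rewrite eq_le fnorm_ge0 andbT -(pmulr_rle0 _ c0).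
have [J1 [J1J J1K J1d]] : exists J1 : {set 'I_n}, [/\ J1 \subset [set: 'I_n]%SET,
    #|J1| = K & forall i j, i \in J1 -> j \in [set: 'I_n]%SET :\: J1 -> d 0 j <= d 0 i].
  by apply: top_subset; rewrite finset.cardsT card_ord ltnW.
have DX := XU _ _ J1J; rewrite XT in DX; set J2 := _ :\: J1 in J1d DX.
have Td : trace_norm D = \sum_(j in J1) d 0 j + \sum_(j in J2) d 0 j.
  rewrite dT (bigID (mem J1))/=; congr (_ + _); apply: eq_bigl => j.
  by rewrite !inE andbT.
have tail (q : 'M[R]_n -> R) (L' : R) : 0 <= L' ->
    (forall X Y, q (X + Y) <= q X + q Y) ->
    (forall J : {set 'I_n}, (#|J| <= K)%N -> q (X J) <= L' * fnorm (X J)) ->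
    q (X J2) <= L' * (trace_norm D / Num.sqrt K%:R).
  move=> L'0 qD qlow.
  apply: le_trans (blk q L' L'0 qD qlow J2 ((\sum_(j in J1) d 0 j) / K%:R) _ _) _.
  - by rewrite divr_ge0 ?sumr_ge0.
  - move=> j jJ; rewrite ler_pdivlMr ?ltr0n// mulr_natr -J1K -sumr_const.
    by apply: ler_sum => i iJ; apply: J1d.
  by rewrite ler_wpM2l// Td mulrDl sKd.
have t1 := tail p L L0 pD (fun J JK => proj2 (andP (low J JK))).
have t2 : fnorm (X J2) <= trace_norm D / Num.sqrt K%:R.
  by rewrite -[leRHS]mul1r; apply: tail => // [|J _]; [exact: fnormD|rewrite mul1r].
have /andP[t3 _] := low J1 (eq_leq J1K).
have t4 := fnormD (X J1) (X J2); rewrite -DX in t4.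
have t5 : p (X J1) <= p (X J2).
  have := pD D (- X J2); rewrite {1}DX addrK pD0 add0r.
  by rewrite -scaleN1r pZ normrN1 mul1r.
have t6 : trace_norm D / Num.sqrt K%:R <= s * fnorm D / Num.sqrt K%:R.
  by rewrite ler_wpM2r// invr_ge0 ltW.
apply: fnorm_eq0; apply/eqP; rewrite eq_le fnorm_ge0 andbT.
rewrite leNgt; apply/negP => D0.
set T := trace_norm D / _ in t1 t2 t6.
(* c |D| <= c |X J1| + c |X J2| <= p (X J1) + c T <= p (X J2) + c T <= (L + c) T. *)
have : c * fnorm D <= (c + L) * (s * fnorm D / Num.sqrt K%:R) by nra.
rewrite mulrA ler_pdivlMr// => h.
suff : c * Num.sqrt K%:R <= s * (c + L) by rewrite leNgt sK.
by rewrite -(ler_pM2r D0); nra.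
Qed.

End Blocks.

(** * Moments of bilinear measurements *)

Section Tails.
Context {R : realType}.

(** For t <= 1 use exp(-t) <= 1/(1+t) <= 1 - t/2 <= 1 - t^2/2. For t > 1 the left side is at most
    1/2, and the right side exceeds 1/2 by (t^2 - 2)^2 / 8. *)
Lemma expRN_le (t : R) : 0 <= t -> expR (- t) <= 1 - t ^+ 2 / 2 + t ^+ 4 / 8.
Proof.
move=> t0; have e1 := expR_ge1Dx t; have e0 := expR_gt0 t.
rewrite expRN; have [t1|t1] := leP t 1.
  apply: (@le_trans _ _ (1 - t / 2)).
    by rewrite -[leLHS]div1r ler_pdivrMr//; nra.
  suff : 0 <= t ^+ 4 / 8 + t * (1 - t) / 2 by lra.
  by rewrite addr_ge0 ?divr_ge0 ?exprn_ge0 ?mulr_ge0 ?subr_ge0.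
apply: (@le_trans _ _ (1 / 2)).
  by rewrite -[leLHS]div1r ler_pdivrMr//; lra.
suff : 0 <= (t ^+ 2 - 2) ^+ 2 / 8 by lra.
by rewrite divr_ge0 ?sqr_ge0.
Qed.

(** The tangent of exp at the mean lies below exp, and its average is the value at the mean. *)
Lemma expR_jensen (I : finType) (p c : I -> R) : (forall i, 0 <= p i) ->
  \sum_i p i = 1 -> expR (\sum_i p i * c i) <= \sum_i p i * expR (c i).
Proof.
move=> p0 p1; set S := \sum_i _.
have -> : expR S = \sum_i p i * (expR S * (1 + (c i - S))).
  under eq_bigr do rewrite mulrCA.
  rewrite -mulr_sumr -[LHS]mulr1; congr (_ * _).
  under eq_bigr do rewrite mulrDr mulr1 mulrBr.
  by rewrite !big_split/= sumrN -mulr_suml p1 mul1r -/S subrr addr0.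
apply: ler_sum => i _; rewrite ler_wpM2l//.
have -> : expR (c i) = expR S * expR (c i - S) by rewrite -expRD addrC subrK.
by rewrite ler_wpM2l ?expR_ge0// expR_ge1Dx.
Qed.

(* The parabola [t ^ 2 / 8] is the supremum over real [m] of [m t - 2 m ^ 2];
   integer [m] loses at most [2]. *)
Lemma expR_sqr_le n (t : R) : `|t| <= n%:R ->
  expR (t ^+ 2 / 8) <= expR 2 * \sum_(m < n.+1)
    expR (- (2 * m%:R ^+ 2)) * (expR (m%:R * t) + expR (- (m%:R * t))).
Proof.
move=> tn; pose k := Num.truncn (`|t| / 4).
have /andP[k1 k2] : k%:R <= `|t| / 4 < k.+1%:R by rewrite truncn_itv ?divr_ge0.
move: k k1 k2 => k k1 k2.
have kn : (k < n.+1)%N.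
  rewrite ltnS -(ler_nat R) (le_trans k1)//; have := normr_ge0 t; lra.
rewrite (bigD1 (Ordinal kn))//= mulrDr; apply: ler_wpDr.
  by rewrite mulr_ge0 ?expR_ge0// sumr_ge0// => m _; rewrite mulr_ge0 ?addr_ge0 ?expR_ge0.
apply: (@le_trans _ _ (expR (2 - 2 * k%:R ^+ 2 + k%:R * `|t|))).
  rewrite ler_expR -(real_normK (num_real t)).
  rewrite -[k.+1%:R]natr1 in k2.
  suff : 0 <= 2 * (1 - (`|t| / 4 - k%:R) ^+ 2) by lra.
  have z0 : 0 <= `|t| / 4 - k%:R by lra.
  have z1 : `|t| / 4 - k%:R <= 1 by lra.
  have := exprn_ile1 2 z0 z1; lra.
rewrite !expRD -mulrA ler_wpM2l ?expR_ge0// ler_wpM2l ?expR_ge0//.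
by have [t0|t0] := ger0P t; rewrite ?mulrN ?lerDl ?lerDr expR_ge0.
Qed.

Lemma expR1_ge2 : 2 <= expR 1 :> R.
Proof. by have := expR_ge1Dx (1 : R); lra. Qed.

Lemma sum_expRN_sqr n : \sum_(m < n) expR (- (m%:R ^+ 2)) <= 2 :> R.
Proof.
apply: (@le_trans _ _ (\sum_(m < n) 2^-1 ^+ m)).
  apply: ler_sum => m _; rewrite expRN exprVn lef_pV2 ?posrE ?expR_gt0 ?exprn_gt0//.
  apply: (@le_trans _ _ (expR 1 ^+ m)); first by rewrite lerXn2r ?nnegrE ?expR_ge0 ?expR1_ge2.
  rewrite -expRM_natl ler_expR mulr1 -natrX ler_nat.
  by case: (nat_of_ord m) => // j; rewrite leq_pmulr.
have -> : \sum_(m < n) 2^-1 ^+ m = 2 - 2 * 2^-1 ^+ n :> R.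
  elim: n => [|n IHn]; first by rewrite big_ord0 expr0; lra.
  by rewrite big_ord_recr/= IHn exprS; lra.
by rewrite gerBl mulr_ge0// exprn_ge0.
Qed.

(* What is used of the law of a uniform vector of the sphere after rounding to
   finitely many points: its weights, subgaussianity (up to a factor 2 and for
   vectors that are not too long), and nondegenerate second moments. *)
Definition sphere_like n (F : finType) (rep : F -> 'cV[R]_n) (mu : F -> R) :=
  [/\ forall a, 0 <= mu a,
      \sum_a mu a <= 1,
      forall w : 'cV[R]_n, fnorm w <= n%:R ^+ 2 ->
        \sum_a mu a * expR (mxdot w (rep a)) <= 2 * expR (fnorm w ^+ 2 / n%:R) &
      forall w : 'cV[R]_n,
        3 / 4 * (fnorm w ^+ 2 / n%:R) <= \sum_a mu a * mxdot w (rep a) ^+ 2].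

Section Pair.
Context {n : nat} {F : finType} (rep : F -> 'cV[R]_n).
Hypothesis n0 : (0 < n)%N.
Hypothesis rep1 : forall a i, `|rep a i ord0| <= 1.
Context (mu nu : F -> R).
Hypotheses (mus : sphere_like rep mu) (nus : sphere_like rep nu).

Let nR : 0 < n%:R :> R. Proof. by rewrite ltr0n. Qed.
Let n1 : 1 <= n%:R :> R. Proof. by rewrite ler1n. Qed.

Lemma rep_fnorm a : fnorm (rep a) ^+ 2 <= n%:R.
Proof. by rewrite -[leRHS]mulr1 -[X in _ <= _ * X](expr1n _ 2) fnorm_box. Qed.

Lemma rep_fnorm_sqrt a : fnorm (rep a) <= Num.sqrt n%:R.
Proof.
rewrite -(ler_pXn2r (n := 2)) ?nnegrE ?sqrtr_ge0 ?fnorm_ge0//.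
by rewrite [leRHS]sqr_sqrtr ?rep_fnorm// ler0n.
Qed.

Let sqrtn : Num.sqrt n%:R ^+ 2 = n%:R :> R.
Proof. by rewrite sqr_sqrtr// ler0n. Qed.

Let sqrtn_le : Num.sqrt n%:R <= n%:R :> R.
Proof.
rewrite -(ler_pXn2r (n := 2)) ?nnegrE ?sqrtr_ge0 ?ler0n// sqrtn expr2.
by rewrite ler_peMl ?ler0n.
Qed.

(** [expR_sqr_le] linearizes the square. Subgaussianity for the vectors m sqrt n x and their
    opposites gives 2 exp(m^2) each, which the weights exp(-2 m^2) make summable. Since m <= n,
    these vectors have norm at most n^2, as [sphere_like] demands. *)
Lemma sqr_exp_moment (x : 'cV[R]_n) : fnorm x = 1 ->
  \sum_b nu b * expR (n%:R * mxdot x (rep b) ^+ 2 / 8) <= 8 * expR 2.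
Proof.
move=> x1; case: nus => nu0 _ nuSG _.
have bound b : expR (n%:R * mxdot x (rep b) ^+ 2 / 8) <= expR 2 * \sum_(m < n.+1)
    expR (- (2 * m%:R ^+ 2)) * (expR (mxdot ((m%:R * Num.sqrt n%:R) *: x) (rep b)) +
    expR (mxdot ((- (m%:R * Num.sqrt n%:R)) *: x) (rep b))).
  have := @expR_sqr_le n (Num.sqrt n%:R * mxdot x (rep b)).
  rewrite exprMn sqrtn => h; apply: (le_trans (h _)).
    rewrite normrM ger0_norm ?sqrtr_ge0// -[leRHS]sqrtn expr2.
    rewrite ler_wpM2l ?sqrtr_ge0//; apply: (le_trans (mxdot_CS_norm _ _)).
    by rewrite x1 mul1r rep_fnorm_sqrt.
  rewrite ler_wpM2l ?expR_ge0//; apply: ler_sum => m _.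
  by rewrite !mxdotZl mulNr (mulrA m%:R (Num.sqrt _)).
have SG (m : 'I_n.+1) e : `|e| = 1 ->
    \sum_b nu b * expR (mxdot ((e * (m%:R * Num.sqrt n%:R)) *: x) (rep b)) <=
    2 * expR (m%:R ^+ 2).
  move=> e1; have fn : fnorm ((e * (m%:R * Num.sqrt n%:R)) *: x) = m%:R * Num.sqrt n%:R.
    by rewrite fnormZ x1 mulr1 normrM e1 mul1r ger0_norm// mulr_ge0 ?sqrtr_ge0.
  apply: (le_trans (nuSG _ _)); last first.
    by rewrite fn exprMn sqrtn mulfK ?gt_eqF.
  rewrite fn expr2; apply: ler_pM; rewrite ?ler0n ?sqrtr_ge0//.
  by rewrite ler_nat -ltnS.
apply: (@le_trans _ _ (\sum_b expR 2 * \sum_(m < n.+1) expR (- (2 * m%:R ^+ 2)) *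
   (nu b * expR (mxdot ((1 * (m%:R * Num.sqrt n%:R)) *: x) (rep b)) +
    nu b * expR (mxdot ((-1 * (m%:R * Num.sqrt n%:R)) *: x) (rep b))))).
  apply: ler_sum => b _; apply: (le_trans (ler_wpM2l (nu0 b) (bound b))).
  rewrite mulrCA ler_wpM2l ?expR_ge0// mulr_sumr; apply: ler_sum => m _.
  by rewrite mulrCA mulrDr mul1r mulN1r.
rewrite -mulr_sumr exchange_big/= mulrC ler_wpM2r ?expR_ge0//.
apply: (@le_trans _ _ (\sum_(m < n.+1) 4 * expR (- (m%:R ^+ 2)))).
  apply: ler_sum => m _; rewrite -mulr_sumr big_split/=.
  have h := lerD (SG m 1 (normr1 _)) (SG m (-1) (normrN1 _)).
  apply: (le_trans (ler_wpM2l (expR_ge0 _) h)).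
  rewrite -mulrDl mulrCA -expRD (_ : 2 + 2 = 4 :> R); last by lra.
  by rewrite (_ : - _ + _ = - (m%:R ^+ 2)) //; lra.
rewrite -mulr_sumr; have := sum_expRN_sqr n.+1; lra.
Qed.

(** The squared norms of the rows of [X] are convex weights, so Jensen's inequality reduces the
    claim to normalized rows [z i]. Zero rows carry weight 0. *)
Lemma frob_exp_moment (X : 'M[R]_n) : fnorm X = 1 ->
  \sum_b nu b * expR (n%:R * fnorm (X *m rep b) ^+ 2 / 8) <= 8 * expR 2.
Proof.
move=> X1; case: (nus) => nu0 _ _ _.
pose y i := (row i X)^T.
have Xb b : fnorm (X *m rep b) ^+ 2 = \sum_i mxdot (y i) (rep b) ^+ 2.
  rewrite fnorm_sqr mxdotE; apply: eq_bigr => i _; rewrite big_ord1 -expr2.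
  congr (_ ^+ 2); rewrite mxE mxdotE; apply: eq_bigr => k _.
  by rewrite big_ord1 !mxE.
have Xy : \sum_i fnorm (y i) ^+ 2 = 1.
  rewrite -[RHS](expr1n _ 2) -X1 fnorm_sqr mxdotE; apply: eq_bigr => i _.
  by rewrite fnorm_sqr mxdot_tr mxdotE big_ord1; apply: eq_bigr => j _; rewrite !mxE.
pose z i := if y i == 0 then 0 else (fnorm (y i))^-1 *: y i.
have yz i b : mxdot (y i) (rep b) ^+ 2 = fnorm (y i) ^+ 2 * mxdot (z i) (rep b) ^+ 2.
  rewrite /z; have [y0|y0] := eqVneq (y i) 0.
    by rewrite !(mxdotC _ (rep b)) y0 !mxdot0r expr0n mulr0.
  rewrite mxdotZl exprMn mulrA -exprMn divff ?expr1n ?mul1r//.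
  by rewrite gt_eqF ?fnorm_gt0.
apply: (@le_trans _ _ (\sum_b nu b * \sum_i fnorm (y i) ^+ 2 *
    expR (n%:R * mxdot (z i) (rep b) ^+ 2 / 8))).
  apply: ler_sum => b _; rewrite ler_wpM2l//; apply: le_trans (expR_jensen _ _ Xy).
    rewrite ler_expR Xb mulr_sumr mulr_suml; apply: ler_sum => i _.
    by rewrite yz; lra.
  by move=> i; exact: sqr_ge0.
under eq_bigr do rewrite mulr_sumr.
rewrite exchange_big/= -[leRHS]mul1r -[X in _ <= X * _]Xy mulr_suml; apply: ler_sum => i _.
under eq_bigr do rewrite mulrCA.
rewrite -mulr_sumr; have [y0|y0] := eqVneq (y i) 0.
  by rewrite y0 fnorm0 expr0n !mul0r.
rewrite ler_wpM2l ?sqr_ge0//; apply: sqr_exp_moment.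
by rewrite /z (negPf y0) fnormZ ger0_norm ?invr_ge0 ?fnorm_ge0// mulVf// gt_eqF ?fnorm_gt0.
Qed.

Definition bilin (X : 'M[R]_n) (ab : F * F) : R :=
  n%:R * mxdot (rep ab.1) (X *m rep ab.2).

(** For fixed [b], subgaussianity in the other vector, applied to (n/4) X b and its opposite, leaves
    exp(n |X b|^2 / 16) up to a factor; the moment in [b] then bounds this. *)
Lemma bilin_exp_moment (X : 'M[R]_n) : fnorm X = 1 ->
  \sum_ab mu ab.1 * nu ab.2 * expR (`|bilin X ab| / 4) <= 32 * expR 2.
Proof.
move=> X1; case: (mus) => mu0 _ muSG _; case: (nus) => nu0 _ _ _.
have SG b e : `|e| = 1 -> \sum_a mu a * expR (e / 4 * bilin X (a, b)) <=
    2 * expR (n%:R * fnorm (X *m rep b) ^+ 2 / 8).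
  move=> e1; have fn : fnorm ((e / 4 * n%:R) *: (X *m rep b)) =
      n%:R / 4 * fnorm (X *m rep b).
    by rewrite fnormZ !normrM e1 mul1r normfV !normr_nat [n%:R / 4]mulrC.
  rewrite (eq_bigr (fun a => mu a * expR (mxdot ((e / 4 * n%:R) *: (X *m rep b)) (rep a)))).
    apply: (le_trans (muSG _ _)); last first.
      rewrite ler_wpM2l// ler_expR fn exprMn.
      rewrite (_ : (n%:R / 4) ^+ 2 * _ / _ = n%:R * fnorm (X *m rep b) ^+ 2 / 16).
        by have := mulr_ge0 (ltW nR) (sqr_ge0 (fnorm (X *m rep b))); lra.
      by field; rewrite gt_eqF.
    have h1 := fnorm_mulmx X (rep b); rewrite X1 mul1r in h1.
    have h2 := le_trans h1 (le_trans (rep_fnorm_sqrt b) sqrtn_le).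
    rewrite fn; have := fnorm_ge0 (X *m rep b) => h0.
    rewrite expr2 ler_pM ?divr_ge0//; have := n1; lra.
  by move=> a _; rewrite /bilin/= mxdotZl mulrA (mxdotC (rep a)).
have -> : \sum_ab mu ab.1 * nu ab.2 * expR (`|bilin X ab| / 4) =
   \sum_b nu b * \sum_a mu a * expR (`|bilin X (a, b)| / 4).
  under [RHS]eq_bigr do rewrite mulr_sumr.
  rewrite exchange_big pair_big; apply: eq_bigr => -[a b] _ /=.
  by rewrite mulrCA mulrA.
apply: (@le_trans _ _ (\sum_b nu b * (4 * expR (n%:R * fnorm (X *m rep b) ^+ 2 / 8)))).
  apply: ler_sum => b _; rewrite ler_wpM2l//.
  have h := lerD (SG b 1 (normr1 _)) (SG b (-1) (normrN1 _)).
  rewrite -big_split/= in h.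
  apply: (@le_trans _ _ (2 * expR (n%:R * fnorm (X *m rep b) ^+ 2 / 8) +
                     2 * expR (n%:R * fnorm (X *m rep b) ^+ 2 / 8))); last by lra.
  apply: le_trans h; apply: ler_sum => a _; rewrite -mulrDr ler_wpM2l//.
  have [z0|z0] := ger0P (bilin X (a, b)).
    by rewrite (_ : _ / 4 = 1 / 4 * bilin X (a, b)) ?lerDl ?expR_ge0//; lra.
  by rewrite (_ : _ / 4 = -1 / 4 * bilin X (a, b)) ?lerDr ?expR_ge0//; lra.
under eq_bigr do rewrite mulrCA.
rewrite -mulr_sumr; have := frob_exp_moment X1; lra.
Qed.

(** The second moment bound is used once for each vector, and (3/4)^2 = 9/16 >= 1/2. *)
Lemma bilin_sqr_moment (X : 'M[R]_n) : fnorm X = 1 ->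
  1 / 2 <= \sum_ab mu ab.1 * nu ab.2 * bilin X ab ^+ 2.
Proof.
move=> X1; case: (mus) => mu0 _ _ muSM; case: (nus) => nu0 _ _ nuSM.
have -> : \sum_ab mu ab.1 * nu ab.2 * bilin X ab ^+ 2 =
   \sum_b nu b * (n%:R ^+ 2 * \sum_a mu a * mxdot (X *m rep b) (rep a) ^+ 2).
  under [RHS]eq_bigr do rewrite !mulr_sumr.
  rewrite exchange_big pair_big; apply: eq_bigr => -[a b] _ /=.
  by rewrite /bilin/= exprMn (mxdotC (rep a)); ring.
apply: (@le_trans _ _ (\sum_b nu b * (3 / 4 * n%:R * fnorm (X *m rep b) ^+ 2))).
  under eq_bigr do rewrite mulrCA.
  rewrite -mulr_sumr.
  have -> : \sum_b nu b * fnorm (X *m rep b) ^+ 2 =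
      \sum_i \sum_b nu b * mxdot (row i X)^T (rep b) ^+ 2.
    rewrite exchange_big; apply: eq_bigr => b _; rewrite -mulr_sumr; congr (_ * _).
    rewrite fnorm_sqr mxdotE; apply: eq_bigr => i _; rewrite big_ord1 -expr2.
    congr (_ ^+ 2); rewrite mxE mxdotE; apply: eq_bigr => k _.
    by rewrite big_ord1 !mxE.
  apply: (@le_trans _ _ (3 / 4 * n%:R * \sum_i 3 / 4 * (fnorm (row i X)^T ^+ 2 / n%:R))).
    rewrite -mulr_sumr -mulr_suml.
    have -> : \sum_i fnorm (row i X)^T ^+ 2 = 1.
      rewrite -[RHS](expr1n _ 2) -X1 fnorm_sqr mxdotE; apply: eq_bigr => i _.
      by rewrite fnorm_sqr mxdot_tr mxdotE big_ord1; apply: eq_bigr => j _; rewrite !mxE.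
    rewrite (_ : 3 / 4 * n%:R * _ = 9 / 16); first by lra.
    by field; rewrite gt_eqF.
  rewrite ler_wpM2l ?mulr_ge0 ?ler0n//.
  by apply: ler_sum => i _; apply: nuSM.
apply: ler_sum => b _; rewrite ler_wpM2l//.
apply: (@le_trans _ _ (n%:R ^+ 2 * (3 / 4 * (fnorm (X *m rep b) ^+ 2 / n%:R)))).
  by rewrite le_eqVlt; apply/orP; left; apply/eqP; field; rewrite gt_eqF.
by rewrite ler_wpM2l ?sqr_ge0.
Qed.

End Pair.

(* Bounds the fourth moment of [bilin]: [z ^ 4 <= 16 ^ 4 * expR (z / 4)] and
   [bilin_exp_moment]. *)
Definition moment4 : R := 16 ^+ 4 * (32 * expR 2).

Lemma moment4_ge1 : 1 <= moment4.
Proof. by have := expR_ge1Dx (2 : R); rewrite /moment4; lra. Qed.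

(** With C = [moment4] and s^2 = 1/C, the quadratic term gains at least 1/(4C) and the quartic term
    loses at most 1/(8C), so the expectation is at most 1 - 1/(8C). *)
Lemma bilin_exp_lower n (F : finType) (rep : F -> 'cV[R]_n) mu nu (X : 'M[R]_n) :
  (0 < n)%N -> (forall a i, `|rep a i ord0| <= 1) ->
  sphere_like rep mu -> sphere_like rep nu -> fnorm X = 1 ->
  \sum_ab mu ab.1 * nu ab.2 * expR (- ((Num.sqrt moment4)^-1 * `|bilin rep X ab|)) <=
  expR (- (8 * moment4)^-1).
Proof.
move=> n0 rep1 mus nus X1; case: (mus) => mu0 mu1 _ _; case: (nus) => nu0 nu1 _ _.
have C1 := moment4_ge1; have C0 : 0 < moment4 by lra.
set s := (Num.sqrt _)^-1.
have s0 : 0 <= s by rewrite invr_ge0 sqrtr_ge0.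
have s2 : s ^+ 2 = moment4^-1 by rewrite exprVn sqr_sqrtr ?ltW.
apply: (@le_trans _ _ (\sum_ab mu ab.1 * nu ab.2 *
    (1 - s ^+ 2 / 2 * bilin rep X ab ^+ 2 +
     s ^+ 4 / 8 * (16 ^+ 4 * expR (`|bilin rep X ab| / 4))))).
  apply: ler_sum => ab _; rewrite ler_wpM2l ?mulr_ge0//.
  have h := expRN_le (mulr_ge0 s0 (normr_ge0 (bilin rep X ab))).
  apply: (le_trans h); rewrite ![(s * _) ^+ _]exprMn real_normK ?num_real//.
  have h4 : `|bilin rep X ab| ^+ 4 <= 16 ^+ 4 * expR (`|bilin rep X ab| / 4).
    have := expR_ge1Dx (`|bilin rep X ab| / 16).
    have z0 := normr_ge0 (bilin rep X ab).
    move: (`|_|) z0 => z z0 e1.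
    have e2 : z / 16 <= expR (z / 16) by lra.
    have -> : z / 4 = 4%:R * (z / 16) by lra.
    rewrite expRM_natl; apply: (@le_trans _ _ (16 ^+ 4 * (z / 16) ^+ 4)).
      by rewrite le_eqVlt; apply/orP; left; apply/eqP; field.
    by rewrite ler_wpM2l// lerXn2r ?nnegrE ?divr_ge0 ?expR_ge0.
  have s4 : 0 <= s ^+ 4 by rewrite exprn_ge0.
  rewrite (mulrAC (s ^+ 2)) lerD2l (mulrAC (s ^+ 4) 8^-1) ler_wpM2r// ler_wpM2l//.
have := bilin_exp_moment n0 rep1 mus nus X1.
have := bilin_sqr_moment n0 mus nus X1.
have : \sum_(ab : F * F) mu ab.1 * nu ab.2 <= 1.
  rewrite -(pair_big xpredT xpredT (fun a b => mu a * nu b))/=.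
  under eq_bigr do rewrite -mulr_sumr.
  rewrite -mulr_suml; apply: (@le_trans _ _ (1 * 1)); last by rewrite mulr1.
  by rewrite ler_pM ?sumr_ge0.
move=> h0 h2 h4.
have -> : \sum_ab mu ab.1 * nu ab.2 * (1 - s ^+ 2 / 2 * bilin rep X ab ^+ 2 +
    s ^+ 4 / 8 * (16 ^+ 4 * expR (`|bilin rep X ab| / 4))) =
  \sum_ab mu ab.1 * nu ab.2 - s ^+ 2 / 2 * (\sum_ab mu ab.1 * nu ab.2 * bilin rep X ab ^+ 2)
  + s ^+ 4 / 8 * (16 ^+ 4 * \sum_ab mu ab.1 * nu ab.2 * expR (`|bilin rep X ab| / 4)).
  rewrite !mulr_sumr -sumrN -!big_split/=; apply: eq_bigr => ab _; ring.
apply: le_trans (expR_ge1Dx _).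
have s4 : s ^+ 4 = moment4^-1 ^+ 2 by rewrite -s2 -exprM.
have i0 : 0 < moment4^-1 by rewrite invr_gt0.
have h5 : 16 ^+ 4 * \sum_ab mu ab.1 * nu ab.2 * expR (`|bilin rep X ab| / 4) <= moment4.
  by rewrite /moment4 ler_wpM2l.
have h6 : s ^+ 4 / 8 * (16 ^+ 4 * \sum_ab mu ab.1 * nu ab.2 * expR (`|bilin rep X ab| / 4))
     <= moment4^-1 / 8.
  apply: (le_trans (ler_wpM2l _ h5)); first by rewrite s4 divr_ge0 ?sqr_ge0.
  by rewrite s4 le_eqVlt; apply/orP; left; apply/eqP; field; rewrite gt_eqF.
have h7 : moment4^-1 / 4 <= s ^+ 2 / 2 *
    (\sum_ab mu ab.1 * nu ab.2 * bilin rep X ab ^+ 2).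
  by rewrite s2; nra.
rewrite invfM; lra.
Qed.

End Tails.

(** * Concentration over a net of low-rank matrices *)

Section Net.
Context {R : realType}.

(** The weight of a configuration is a product, so by distributivity the exponential moment of the
    sum factorizes; Markov's inequality does the rest. *)
Lemma chernoff (I : finType) M (q : 'I_M -> I -> R) (g : I -> R) (rho t : R) :
  (forall i x, 0 <= q i x) ->
  (forall i, \sum_x q i x * expR (g x) <= rho) ->
  \sum_(phi : {ffun 'I_M -> I} | t <= \sum_i g (phi i)) \prod_i q i (phi i) <=
  rho ^+ M * expR (- t).
Proof.
move=> q0 qg.
apply: (@le_trans _ _ ((\prod_(i < M) \sum_x q i x * expR (g x)) * expR (- t))).
  rewrite bigA_distr_bigA mulr_suml big_mkcond; apply: ler_sum => phi _.
  have w0 : 0 <= \prod_i q i (phi i) by apply: prodr_ge0.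
  rewrite big_split/= -expR_sum -mulrA -expRD; case: ifP => [tg|_]; last first.
    by rewrite mulr_ge0 ?expR_ge0.
  by rewrite ler_peMr// -expR0 ler_expR subr_ge0.
rewrite ler_wpM2r ?expR_ge0// -[in leRHS](card_ord M) -prodr_const.
by apply: ler_prod => i _; rewrite qg andbT sumr_ge0// => x _; rewrite mulr_ge0 ?expR_ge0.
Qed.

Lemma sum_exists_le (I J : finType) (P : J -> pred I) (w : I -> R) :
  (forall x, 0 <= w x) ->
  \sum_(x | [exists j, P j x]) w x <= \sum_j \sum_(x | P j x) w x.
Proof.
move=> w0; under [leRHS]eq_bigr do rewrite big_mkcond.
rewrite exchange_big big_mkcond; apply: ler_sum => x _.
case: ifP => [/existsP[j Pj]|_]; last by apply: sumr_ge0 => j _; case: ifP.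
by rewrite (bigD1 j)//= Pj lerDl sumr_ge0// => k _; case: ifP.
Qed.

(** The constants balance the two Chernoff bounds, with C = [moment4]. Below, exp(-M/(8C)) is
    multiplied by exp(M/(16C)), which leaves exp(- [rip_rate] M). Above, [rip_upper] / 4 exceeds the
    logarithm of the exponential moment by 1, which leaves exp(-M). *)
Definition rip_lower : R := (16 * Num.sqrt moment4)^-1.
Definition rip_upper : R := 4 * (ln (32 * expR 2) + 1).
Definition rip_rate : R := (16 * moment4)^-1.

Lemma rip_lower_gt0 : 0 < rip_lower.
Proof.
have := @moment4_ge1 R => h; rewrite invr_gt0 mulr_gt0// sqrtr_gt0; lra.
Qed.

Lemma rip_lower_le1 : rip_lower <= 1.
Proof.
have h : 1 <= Num.sqrt (moment4 : R) by rewrite -[leLHS]sqrtr1 ler_wsqrtr ?moment4_ge1.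
rewrite invf_le1; lra.
Qed.

Lemma rip_rate_gt0 : 0 < rip_rate.
Proof. have := @moment4_ge1 R => h; rewrite invr_gt0; lra. Qed.

Lemma rip_upper_ge0 : 0 <= rip_upper.
Proof.
rewrite /rip_upper mulr_ge0// addr_ge0// ln_ge0//.
have := expR_ge1Dx (2 : R); lra.
Qed.

Lemma bilinZ n (F : finType) (rep : F -> 'cV[R]_n) a X ab :
  bilin rep (a *: X) ab = a * bilin rep X ab.
Proof. by rewrite /bilin -scalemxAl mxdotZr mulrCA. Qed.

(** * Both tails for a single matrix *)

Section Config.
Context {n : nat} {F : finType} (rep : F -> 'cV[R]_n) (M : nat).
Hypothesis n0 : (0 < n)%N.
Hypothesis rep1 : forall a i, `|rep a i ord0| <= 1.
Context (mu nu : 'I_M -> F -> R).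
Hypotheses (mus : forall i, sphere_like rep (mu i))
           (nus : forall i, sphere_like rep (nu i)).

Let wt (phi : {ffun 'I_M -> F * F}) := \prod_i (mu i (phi i).1 * nu i (phi i).2).

Definition concentrated (X : 'M[R]_n) (phi : {ffun 'I_M -> F * F}) :=
  rip_lower * M%:R < \sum_i `|bilin rep X (phi i)| < rip_upper * M%:R.

Lemma concentrated_tail (X : 'M[R]_n) : fnorm X = 1 ->
  \sum_(phi | ~~ concentrated X phi) wt phi <= 2 * expR (- (rip_rate * M%:R)).
Proof.
move=> X1.
have q0 i (ab : F * F) : 0 <= mu i ab.1 * nu i ab.2.
  by case: (mus i) (nus i) => m0 _ _ _ [k0 _ _ _]; rewrite mulr_ge0.
have w0 phi : 0 <= wt phi by apply: prodr_ge0.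
have C1 := @moment4_ge1 R.
have upper := chernoff (rip_upper * M%:R / 4) q0
  (fun i => bilin_exp_moment n0 rep1 (mus i) (nus i) X1).
set s := (Num.sqrt (moment4 : R))^-1.
have s0 : 0 < s by rewrite invr_gt0 sqrtr_gt0; lra.
have lower := @chernoff _ M _ (fun ab => - (s * `|bilin rep X ab|)) _
  (- (s * (rip_lower * M%:R))) q0
  (fun i => bilin_exp_lower n0 rep1 (mus i) (nus i) X1).
have eU : (32 * expR 2) ^+ M * expR (- (rip_upper * M%:R / 4)) <=
    expR (- (rip_rate * M%:R)).
  have h0 : 0 < 32 * expR 2 :> R by rewrite mulr_gt0 ?expR_gt0.
  rewrite -{1}[32 * _](lnK h0) -expRM_natl -expRD ler_expR.
  have rM : rip_rate * M%:R <= M%:R.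
    by rewrite ler_piMl// invf_le1; lra.
  apply: le_trans (_ : - M%:R <= _); last by lra.
  by rewrite /rip_upper le_eqVlt; apply/orP; left; apply/eqP; field.
have eL : expR (- (8 * moment4)^-1) ^+ M * expR (- - (s * (rip_lower * M%:R))) <=
    expR (- (rip_rate * M%:R)).
  rewrite -expRM_natl -expRD ler_expR opprK.
  have sl : s * rip_lower = rip_rate.
    rewrite /s /rip_lower /rip_rate -invfM mulrCA -expr2 sqr_sqrtr//; lra.
  rewrite (mulrA s) sl (_ : (8 * moment4)^-1 = 2 * rip_rate); first by lra.
  by rewrite /rip_rate; field; rewrite gt_eqF//; lra.
have both := lerD (le_trans upper eU) (le_trans lower eL).
apply: le_trans (le_trans both _); last by lra.
rewrite [leLHS]big_mkcond [X in _ <= X + _]big_mkcond [X in _ <= _ + X]big_mkcond.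
rewrite -big_split/=; apply: ler_sum => phi _.
have w : 0 <= \prod_(i < M) (mu i (phi i).1 * nu i (phi i).2) := w0 phi.
case: ifP => [|_]; last by case: ifP => _; case: ifP => _; rewrite addr_ge0.
rewrite negb_and -!leNgt => /orP[h|h].
  rewrite [X in _ + X]ifT; last first.
    by rewrite sumrN -mulr_sumr lerN2 ler_pM2l.
  by rewrite lerDr; case: ifP.
rewrite ifT; last by rewrite -mulr_suml ler_pM2r.
by rewrite lerDl; case: ifP.
Qed.

End Config.

(** * Rounding to a grid and the union bound *)

Section Grid.
Variable N : nat.
Hypothesis N0 : (0 < N)%N.

Definition gridpt (k : 'I_(2 * N).+1) : R := (k%:R - N%:R) / N%:R.
Definition gridmx m n (A : 'M['I_(2 * N).+1]_(m, n)) : 'M[R]_(m, n) := map_mx gridpt A.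

Let N0R : 0 < N%:R :> R. Proof. by rewrite ltr0n. Qed.

Lemma gridpt_norm k : `|gridpt k| <= 1.
Proof.
rewrite normrM normfV normr_nat ler_pdivrMr// mul1r ler_norml.
have : (k <= 2 * N)%N by rewrite -ltnS ltn_ord.
rewrite -(ler_nat R) natrM => h; have k0 := ler0n R k.
by apply/andP; split; lra.
Qed.

Lemma gridmx_norm m n (A : 'M['I_(2 * N).+1]_(m, n)) i j : `|gridmx A i j| <= 1.
Proof. by rewrite mxE gridpt_norm. Qed.

(** Rounding down, not to the nearest point, makes the intervals half-open and disjoint. The last
    grid point, 1, is there to receive x = 1. *)
Lemma gridpt_exists (x : R) : `|x| <= 1 ->
  exists k, gridpt k <= x < gridpt k + N%:R^-1.
Proof.
rewrite ler_norml => /andP[x0 x1]; pose k := Num.truncn ((x + 1) * N%:R).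
have y0 : 0 <= (x + 1) * N%:R by rewrite mulr_ge0//; lra.
have := truncn_itv y0; rewrite -/k => /andP[k1 k2].
have kN : (k < (2 * N).+1)%N.
  rewrite ltnS -(ler_nat R) (le_trans k1)// natrM ler_wpM2r//; lra.
exists (Ordinal kN); rewrite /gridpt/=.
have -> : (k%:R - N%:R) / N%:R + N%:R^-1 = (k%:R - N%:R + 1) / N%:R :> R.
  by rewrite [RHS]mulrDl mul1r.
rewrite ler_pdivrMr// ltr_pdivlMr//; rewrite -[k.+1%:R]natr1 in k2; lra.
Qed.

Lemma gridmx_exists m n (A : 'M[R]_(m, n)) : (forall i j, `|A i j| <= 1) ->
  exists A', forall i j, gridmx A' i j <= A i j < gridmx A' i j + N%:R^-1.
Proof.
move=> A1; have h i j := gridpt_exists (A1 i j).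
exists (\matrix_(i, j) sval (cid (h i j))) => i j.
by rewrite !mxE; case: (cid _).
Qed.

End Grid.

Definition empirical n M (u v : 'I_M -> 'cV[R]_n) (X : 'M[R]_n) : R :=
  M%:R^-1 * \sum_i n%:R * `|mxdot (u i) (X *m v i)|.

(* The net consists of the rank-[K] matrices with factors on the grid; it is so
   fine that rounding errors are absorbed without bootstrapping. *)
Definition good_config n N K M
    (phi : {ffun 'I_M -> 'cV['I_(2 * N).+1]_n * 'cV['I_(2 * N).+1]_n}) : bool :=
  ~~ [exists AB : 'M['I_(2 * N).+1]_(n, K) * 'M['I_(2 * N).+1]_(n, K),
      let X := gridmx AB.1 *m (gridmx AB.2)^T in
      (X != 0) &&
      ~~ concentrated (@gridmx N n 1) ((fnorm X)^-1 *: X) phi].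

Lemma bad_config_tail n N K M (mu nu : 'I_M -> 'cV['I_(2 * N).+1]_n -> R) :
  (0 < n)%N -> (0 < N)%N ->
  (forall i, sphere_like (@gridmx N n 1) (mu i)) ->
  (forall i, sphere_like (@gridmx N n 1) (nu i)) ->
  \sum_(phi | ~~ @good_config n N K M phi)
     \prod_i (mu i (phi i).1 * nu i (phi i).2) <=
  ((2 * N).+1 ^ (2 * (n * K)))%N%:R * (2 * expR (- (rip_rate * M%:R))).
Proof.
move=> n0 N0 mus nus; under eq_bigl do rewrite negbK.
apply: (le_trans (sum_exists_le _ _)).
  move=> phi; apply: prodr_ge0 => i _.
  by case: (mus i) (nus i) => m0 _ _ _ [k0 _ _ _]; rewrite mulr_ge0.
have -> : ((2 * N).+1 ^ (2 * (n * K)))%N =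
    #|{: 'M['I_(2 * N).+1]_(n, K) * 'M['I_(2 * N).+1]_(n, K)}|.
  by rewrite card_prod !card_mx card_ord -expnD addnn -mul2n.
rewrite -sum1_card natr_sum mulr_suml; apply: ler_sum => -[A B] _ /=.
pose X := gridmx A *m (gridmx B)^T; have [X0|X0] := eqVneq X 0.
  rewrite big_pred0; first by rewrite mul1r mulr_ge0 ?expR_ge0.
  by [].
rewrite mul1r (eq_bigl (fun phi => ~~ concentrated (@gridmx N n 1) ((fnorm X)^-1 *: X) phi));
  last by [].
apply: concentrated_tail => //.
- by move=> a i; rewrite gridmx_norm.
- by rewrite fnormZ ger0_norm ?invr_ge0 ?fnorm_ge0// mulVf// gt_eqF ?fnorm_gt0.
Qed.

(** Rounding [A], [B] and all samples keeps the norm of the product in [1/2, 3/2] and moves each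
    measurement by at most a quarter of [rip_lower]. With c and L the constants of [concentrated],
    the bounds become c/2 - c/4 and 3L/2 + c/4. *)
Lemma good_config_rip n N K M phi (u v : 'I_M -> 'cV[R]_n) :
  (0 < n)%N -> (0 < N)%N -> (0 < K)%N -> (0 < M)%N ->
  24 * n%:R ^+ 3 * K%:R <= rip_lower * N%:R ->
  @good_config n N K M phi ->
  (forall i j, `|u i j ord0| <= 1) -> (forall i j, `|v i j ord0| <= 1) ->
  (forall i j, `|u i j ord0 - gridmx (phi i).1 j ord0| <= N%:R^-1) ->
  (forall i j, `|v i j ord0 - gridmx (phi i).2 j ord0| <= N%:R^-1) ->
  forall A B : 'M[R]_(n, K),
    (forall i j, `|A i j| <= 1) -> (forall i j, `|B i j| <= 1) ->
    fnorm (A *m B^T) = 1 ->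
    rip_lower / 4 <= empirical u v (A *m B^T) <= 2 * rip_upper + 1.
Proof.
move=> n0 N0 K0 M0 big good u1 v1 ua va A B A1 B1.
have NR : 0 < N%:R :> R by rewrite ltr0n.
have nR : 1 <= n%:R :> R by rewrite ler1n.
have KR : 1 <= K%:R :> R by rewrite ler1n.
have MR : 0 < M%:R :> R by rewrite ltr0n.
have c0 := rip_lower_gt0; have c1 := rip_lower_le1; have L0 := rip_upper_ge0.
have [A' A'P] := gridmx_exists N0 A1; have [B' B'P] := gridmx_exists N0 B1.
set X := A *m B^T => X1.
have [X' X'E] : exists X', X' = gridmx A' *m (gridmx B')^T by eexists.
have iN0 : 0 <= N%:R^-1 :> R by rewrite invr_ge0 ltW.
have NE : N%:R^-1 * N%:R = 1 :> R by rewrite mulVf ?gt_eqF.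
set e := N%:R^-1 in iN0 NE ua va A'P B'P.
have XX' : fnorm (X - X') <= n%:R * (K%:R * (2 * e)).
  apply: fnorm_square_le; first by rewrite !mulr_ge0.
  move=> i j; rewrite X'E !mxE -sumrB.
  apply: (le_trans (ler_norm_sum _ _ _)).
  apply: (@le_trans _ _ (\sum_(k < K) 2 * e)); last first.
    by rewrite sumr_const card_ord [leRHS]mulr_natl.
  apply: ler_sum => k _; rewrite [B^T k j]mxE [_^T k j]mxE.
  have := A'P i k; have := B'P j k; have := B1 j k; have := @gridmx_norm N N0 _ _ A' i k.
  move: (A i k) (B j k) (gridmx A' i k) (gridmx B' j k) => a b a' b' h1 h2 h3 h4.
  have -> : a * b - a' * b' = (a - a') * b + a' * (b - b') by ring.
  apply: (le_trans (ler_normD _ _)); rewrite !normrM mulr2n mulrDl !mul1r.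
  have t1 : `|a - a'| <= e by rewrite ger0_norm; lra.
  have t2 : `|b - b'| <= e by rewrite ger0_norm; lra.
  apply: lerD.
    by rewrite -[leRHS]mulr1; exact: (ler_pM (normr_ge0 _) (normr_ge0 _) t1 h2).
  by rewrite -[leRHS]mul1r; exact: (ler_pM (normr_ge0 _) (normr_ge0 _) h1 t2).
have ne : 24 * n%:R ^+ 3 * K%:R * e <= rip_lower.
  by rewrite /e ler_pdivrMr.
have n3 : n%:R ^+ 1 <= n%:R ^+ 3 :> R by rewrite ler_weXn2l.
have n23 : n%:R ^+ 2 <= n%:R ^+ 3 :> R by rewrite ler_weXn2l.
rewrite expr1 in n3.
have Ke0 : 0 <= K%:R * e by rewrite mulr_ge0.
have h3 : n%:R * (K%:R * e) <= n%:R ^+ 3 * (K%:R * e) by rewrite ler_wpM2r.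
have dX : fnorm (X - X') <= 1 / 4.
  apply: (le_trans XX'); rewrite (_ : n%:R * _ = 2 * (n%:R * (K%:R * e))); last by ring.
  lra.
have X'l : 1 / 2 <= fnorm X'.
  have := fnormD (X - X') X'; rewrite subrK X1; lra.
have X'u : fnorm X' <= 3 / 2.
  have := fnormD (X' - X) X; rewrite subrK X1 -opprB -scaleN1r fnormZ normrN1 mul1r; lra.
have X'0 : X' != 0.
  by apply/eqP => h; move: X'l; rewrite h fnorm0; lra.
(* The errors from rounding [X], [u i] and [v i] add up to at most 5 n^3 K / N, which the constant
   24 makes at most 5/24 of [rip_lower]. *)
have close i : `|n%:R * `|mxdot (u i) (X *m v i)| - `|bilin (@gridmx N n 1) X' (phi i)| | <=
    rip_lower / 4.
  rewrite /bilin normrM normr_nat -mulrBr normrM normr_nat.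
  set a := gridmx (phi i).1; set b := gridmx (phi i).2.
  apply: (@le_trans _ _ (n%:R * (n%:R * (1 * 1) * fnorm (X - X') +
     n%:R * (e * 1) * fnorm X' + n%:R * (1 * e) * fnorm X'))).
    rewrite ler_wpM2l//; apply: (le_trans (ler_dist_dist _ _)).
    have -> : mxdot (u i) (X *m v i) - mxdot a (X' *m b) =
       mxdot (u i) ((X - X') *m v i) + mxdot (u i - a) (X' *m v i) +
       mxdot a (X' *m (v i - b)).
      rewrite mulmxBl mulmxBr !(mxdotDl, mxdotDr, mxdotNl, mxdotNr); ring.
    apply: (le_trans (ler_normD _ _)); apply: lerD.
      apply: (le_trans (ler_normD _ _)); apply: lerD; apply: mxdot_box => //.
      by move=> j; rewrite !mxE; have := ua i j; rewrite mxE.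
    apply: mxdot_box => // j; first exact: gridmx_norm.
    by rewrite !mxE; have := va i j; rewrite mxE.
  have t1 : n%:R ^+ 2 * fnorm (X - X') <= n%:R ^+ 2 * (n%:R * (K%:R * (2 * e))).
    by rewrite ler_wpM2l ?sqr_ge0.
  have t2 : n%:R ^+ 2 * e * fnorm X' <= n%:R ^+ 2 * e * (3 / 2).
    by rewrite ler_wpM2l ?mulr_ge0 ?sqr_ge0.
  have t3 : n%:R ^+ 2 * e <= n%:R ^+ 3 * (K%:R * e).
    rewrite ler_pM ?mulr_ge0 ?sqr_ge0//.
    by rewrite -[leLHS]mul1r ler_wpM2r.
  have -> : n%:R * (n%:R * (1 * 1) * fnorm (X - X') +
     n%:R * (e * 1) * fnorm X' + n%:R * (1 * e) * fnorm X') =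
     n%:R ^+ 2 * fnorm (X - X') + 2 * (n%:R ^+ 2 * e * fnorm X') by ring.
  rewrite (_ : n%:R ^+ 2 * (n%:R * (K%:R * (2 * e))) = 2 * (n%:R ^+ 3 * (K%:R * e))) in t1;
    last by ring.
  rewrite -mulrA in ne; lra.
have : concentrated (@gridmx N n 1) ((fnorm X')^-1 *: X') phi.
  move: good => /existsPn/(_ (A', B')) /=; rewrite -X'E X'0/=.
  by rewrite negbK.
have f0 : 0 < fnorm X' by lra.
rewrite /concentrated.
under eq_bigr do rewrite bilinZ normrM ger0_norm ?invr_ge0 ?fnorm_ge0//.
rewrite -mulr_sumr ltr_pdivlMl// ltr_pdivrMl//.
set S := \sum_i _ => /andP[S1 S2].
have SS : `|\sum_i n%:R * `|mxdot (u i) (X *m v i)| - S| <= rip_lower / 4 * M%:R.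
  rewrite /S -sumrB; apply: (le_trans (ler_norm_sum _ _ _)).
  apply: (@le_trans _ _ (\sum_(i < M) rip_lower / 4)); first exact: ler_sum.
  by rewrite sumr_const card_ord [leRHS]mulr_natr.
move: SS; rewrite ler_distl => /andP[S3 S4].
rewrite /empirical ler_pdivlMl// ler_pdivrMl//; apply/andP; split.
  have : 1 / 2 * (rip_lower * M%:R) <= fnorm X' * (rip_lower * M%:R).
    by rewrite ler_wpM2r// mulr_ge0// ltW.
  lra.
have : fnorm X' * (rip_upper * M%:R) <= 3 / 2 * (rip_upper * M%:R).
  by rewrite ler_wpM2r// mulr_ge0.
have : 0 <= rip_upper * M%:R by rewrite mulr_ge0.
have : rip_lower * M%:R <= M%:R by rewrite ler_piMl.
lra.
Qed.

End Net.

(** * Uniform distribution on the sphere *)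

(** If |a| >= 1, both exponents are at most a^2. Otherwise put a = 2h: from exp(h) <= 1/(1-h),
    exp(-h) <= 1/(1+h) and exp(2 h^2) >= 1 + 2 h^2, the claim becomes polynomial after
    multiplication by (1 - h^2)^2. *)
Lemma cosh_le {R : realType} (a : R) : expR a + expR (- a) <= 2 * expR (a ^+ 2).
Proof.
have [a1|a1] := leP 1 `|a|.
  have aa : `|a| <= a ^+ 2 by rewrite -real_normK ?num_real// expr2 ler_peMl.
  rewrite mulr2n mulrDl !mul1r lerD// ler_expR (le_trans _ aa)//.
    exact: ler_norm.
  by rewrite -normrN ler_norm.
pose h := a / 2; have h1 : `|h| < 1 / 2 by rewrite normrM normfV normr_nat; lra.
have p1 := expR_ge1Dx h; have q1 := expR_ge1Dx (- h).
have pq : expR h * expR (- h) = 1 by rewrite -expRD subrr expR0.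
have -> : a = 2%:R * h by rewrite /h; lra.
rewrite -mulrN !expRM_natl.
have -> : (2%:R * h) ^+ 2 = 2%:R * (2 * h ^+ 2) by ring.
rewrite expRM_natl; have r1 := expR_ge1Dx (2 * h ^+ 2).
move: h1; rewrite ltr_norml => /andP[h1 h2].
move: (expR h) (expR (- h)) (expR (2 * h ^+ 2)) p1 q1 pq r1 => p q r p1 q1 pq r1.
have x0 := sqr_ge0 h; have x1 : h ^+ 2 <= 1 / 4 by nra.
have pD : p * (1 - h ^+ 2) <= 1 + h.
  have : p * (1 - h) <= 1 by rewrite -[leRHS]pq ler_wpM2l//; lra.
  move=> k; rewrite (_ : _ * _ = p * (1 - h) * (1 + h)); last by ring.
  by rewrite -[leRHS]mul1r ler_wpM2r//; lra.
have qD : q * (1 - h ^+ 2) <= 1 - h.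
  have : q * (1 + h) <= 1 by rewrite -[leRHS]pq [leRHS]mulrC ler_wpM2l//; lra.
  move=> k; rewrite (_ : _ * _ = q * (1 + h) * (1 - h)); last by ring.
  by rewrite -[leRHS]mul1r ler_wpM2r//; lra.
have rD : 1 + h ^+ 2 / 2 <= r * (1 - h ^+ 2).
  apply: (@le_trans _ _ ((1 + 2 * h ^+ 2) * (1 - h ^+ 2))); first by nra.
  by rewrite ler_wpM2r//; lra.
have D0 : 0 < (1 - h ^+ 2) ^+ 2 by rewrite exprn_gt0//; lra.
rewrite -(ler_pM2r D0) mulrDl -mulrA -!exprMn.
have pD2 : (p * (1 - h ^+ 2)) ^+ 2 <= (1 + h) ^+ 2.
  by rewrite lerXn2r ?nnegrE ?mulr_ge0//; lra.
have qD2 : (q * (1 - h ^+ 2)) ^+ 2 <= (1 - h) ^+ 2.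
  by rewrite lerXn2r ?nnegrE ?mulr_ge0//; lra.
have rD2 : (1 + h ^+ 2 / 2) ^+ 2 <= (r * (1 - h ^+ 2)) ^+ 2.
  by rewrite lerXn2r ?nnegrE ?mulr_ge0//; lra.
nra.
Qed.

Section Sphere.
Context {R : realType} {n : nat}.

Lemma measurable_coord i : measurable_fun [set: 'cV[R]_n] (fun x => x i ord0).
Proof.
apply: (measurability _ (RGenOpens.measurableE R)) => _ [_ [a [b ->] <-]].
rewrite setTI; apply: sub_sigma_algebra.
exact: (continuousP _).1 (@coord_continuous R n 1 i ord0) _ (interval_open _ _).
Qed.

Lemma measurable_mxdot w : measurable_fun [set: 'cV[R]_n] (mxdot w).
Proof.
rewrite (_ : mxdot w = fun x => \sum_i w i ord0 * x i ord0); last first.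
  by apply/funext => x; exact: mxdot_cV.
apply: measurable_sum => i; apply: measurable_funM; first exact: measurable_cst.
exact: measurable_coord.
Qed.

Lemma measurable_sphere : measurable [set x : 'cV[R]_n | l2norm x = 1].
Proof.
have m : measurable_fun [set: 'cV[R]_n] (fun x => mxdot x x).
  rewrite (_ : (fun _ => _) = fun x : 'cV[R]_n => \sum_i x i ord0 * x i ord0).
    apply: measurable_sum => i.
    by apply: measurable_funM; exact: measurable_coord.
  by apply/funext => x; exact: mxdot_cV.
rewrite (_ : mkset _ = setT `&` (fun x => mxdot x x) @^-1` [set 1]); first exact: m.
rewrite setTI; apply/seteqP; split => x /=; rewrite l2norm_fnorm.
  by move=> h; rewrite -fnorm_sqr h expr1n.
by rewrite /fnorm => ->; rewrite sqrtr1.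
Qed.

Context {d : measure_display} {T : measurableType d} (P : probability T R).
Context (u : {RV P >-> 'cV[R]_n}).

Lemma measurable_mxdot_RV w : measurable_fun setT (fun t => mxdot w (u t)).
Proof. by apply: measurableT_comp; [exact: measurable_mxdot|exact: measurable_funP]. Qed.

Hypothesis us : uniform_on_sphere u.

Lemma sphere_ae : {ae P, forall t, l2norm (u t) = 1}.
Proof.
have m : measurable [set t | l2norm (u t) = 1].
  by rewrite -[X in measurable X]setTI; exact: (measurable_funP u _ _ measurable_sphere).
exists (~` [set t | l2norm (u t) = 1]); split => //; first exact: measurableC.
by rewrite probability_setC// us.1 subee.
Qed.

(** If Q w = w' with Q orthogonal, then <w, u> = <w', Q u>, and Q u has the law of u. *)
Lemma law_rotation (w w' : 'cV[R]_n) (phi : R -> \bar R) : fnorm w = fnorm w' ->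
  measurable_fun setT phi -> (forall y, (0 <= phi y)%E) ->
  (\int[P]_t phi (mxdot w (u t)) = \int[P]_t phi (mxdot w' (u t)))%E.
Proof.
move=> ww' mphi phi0; have [Q oQ Qw] := ortho_transitive ww'.
pose X z : {mfun T >-> R} :=
  HB.pack (fun t => mxdot z (u t)) (isMeasurableFun.Build _ _ _ _ _ (measurable_mxdot_RV z)).
have E z : (\int[P]_t phi (mxdot z (u t)) = \int[pushforward P (X z)]_y phi y)%E.
  by rewrite (ge0_integral_pushforward (measurable_mxdot_RV z)).
rewrite !E; apply: eq_measure_integral => A mA _; rewrite /pushforward.
have mB : measurable (mxdot w' @^-1` A).
  by rewrite -[X in measurable X]setTI; exact: (measurable_mxdot w').
transitivity (P ((fun t => Q *m u t) @^-1` (mxdot w' @^-1` A))).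
  by congr (P _); apply/seteqP; split=> t /=; rewrite -Qw mxdot_ortho.
exact: us.2 Q oQ _ mB.
Qed.

Hypothesis n0 : (0 < n)%N.

Let nR : 0 < n%:R :> R. Proof. by rewrite ltr0n. Qed.

(* Rotating [w] to a flat vector makes all sign flips of its entries
   equidistributed, so that the average over signs is a product of hyperbolic
   cosines. *)
Lemma sphere_mgf (w : 'cV[R]_n) :
  (\int[P]_t (expR (mxdot w (u t)))%:E <= (expR (fnorm w ^+ 2 / n%:R))%:E)%E.
Proof.
pose c := fnorm w / Num.sqrt n%:R.
have c2 : c ^+ 2 = fnorm w ^+ 2 / n%:R.
  by rewrite expr_div_n [X in _ / X]sqr_sqrtr// ler0n.
pose ws (e : {ffun 'I_n -> bool}) : 'cV[R]_n := \col_j (if e j then c else - c).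
have fw e : fnorm w = fnorm (ws e).
  apply/eqP; rewrite -(eqrXn2 (n := 2)) ?fnorm_ge0//; apply/eqP.
  rewrite (fnorm_sqr (ws e)) mxdot_cV (eq_bigr (fun=> c ^+ 2)); last first.
    by move=> j _; rewrite mxE -expr2; case: (e j); rewrite ?sqrrN.
  by rewrite sumr_const card_ord c2 -[RHS]mulr_natr divfK// gt_eqF.
have mE z : measurable_fun setT (fun t => (expR (mxdot z (u t)))%:E).
  apply/measurable_EFinP; apply: measurableT_comp => //.
  exact: measurable_mxdot_RV.
set I := (\int[P]_t _)%E.
have K0 : 0 < (2 ^ n)%:R :> R by rewrite ltr0n expn_gt0.
have SE : ((2 ^ n)%:R%:E * I = \int[P]_t (\sum_e (expR (mxdot (ws e) (u t)))%:E))%E.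
  rewrite ge0_integral_sum//.
  rewrite (eq_bigr (fun=> I)); last first.
    move=> e _; rewrite /I.
    rewrite (law_rotation (phi := fun y => (expR y)%:E) (esym (fw e)))//.
    exact/measurable_EFinP.
  by rewrite sumr_const card_ffun card_bool card_ord mule_natl.
rewrite -(@lee_pmul2l _ (2 ^ n)%:R%:E)// SE -EFinM.
apply: (@le_trans _ _ (\int[P]_t ((2 ^ n)%:R * expR (fnorm w ^+ 2 / n%:R))%:E)%E); last first.
  by rewrite integral_cst//= probability_setT mule1.
apply: ae_ge0_le_integral => //.
- by move=> t _; apply: sume_ge0 => e _; rewrite lee_fin expR_ge0.
- by apply: emeasurable_sum.
have := sphere_ae; apply: filterS => t ut _; rewrite sumEFin lee_fin.
have -> : \sum_e expR (mxdot (ws e) (u t)) =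
    \prod_j \sum_(b : bool) expR ((if b then c else - c) * u t j ord0).
  rewrite bigA_distr_bigA; apply: eq_bigr => e _.
  by rewrite mxdot_cV -expR_sum; congr expR; apply: eq_bigr => j _; rewrite mxE.
apply: (@le_trans _ _ (\prod_j (2 * expR ((c * u t j ord0) ^+ 2)))).
  apply: ler_prod => j _; rewrite big_bool/= addr_ge0 ?expR_ge0//=.
  by rewrite mulNr cosh_le.
rewrite big_split/= prodr_const card_ord -natrX -expR_sum.
rewrite (eq_bigr (fun j => c ^+ 2 * (u t j ord0 * u t j ord0))); last first.
  by move=> j _; rewrite exprMn expr2.
rewrite -mulr_sumr -mxdot_cV -fnorm_sqr -l2norm_fnorm ut expr1n mulr1 c2.
exact: lexx.
Qed.

(** All multiples |w| e_j of basis vectors give the same integral as [w], and their squared pairings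
    with a unit vector sum to |w|^2. *)
Lemma sphere_second_moment (w : 'cV[R]_n) :
  (n%:R%:E * \int[P]_t (mxdot w (u t) ^+ 2)%:E = (fnorm w ^+ 2)%:E)%E.
Proof.
pose ws j : 'cV[R]_n := fnorm w *: delta_mx j ord0.
have wsE j x : mxdot (ws j) x = fnorm w * x j ord0.
  rewrite mxdotZl mxdot_cV (bigD1 j)//= mxE !eqxx/= mul1r big1 ?addr0// => i ij.
  by rewrite mxE (negPf ij) mul0r.
have fd j : fnorm (delta_mx j ord0 : 'cV[R]_n) = 1.
  rewrite /fnorm mxdot_cV (bigD1 j)//= big1 => [|i ij]; last first.
    by rewrite mxE (negPf ij) mul0r.
  by rewrite mxE !eqxx addr0 mulr1 sqrtr1.
have fw j : fnorm (ws j) = fnorm w.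
  by rewrite fnormZ ger0_norm ?fnorm_ge0// fd mulr1.
have mE z : measurable_fun setT (fun t => (mxdot z (u t) ^+ 2)%:E).
  apply/measurable_EFinP; apply: measurable_funX; exact: measurable_mxdot_RV.
set I := (\int[P]_t (mxdot w (u t) ^+ 2)%:E)%E.
transitivity (\int[P]_t (\sum_(j < n) (mxdot (ws j) (u t) ^+ 2)%:E))%E.
  rewrite ge0_integral_sum//; last by move=> j x _; rewrite lee_fin sqr_ge0.
  rewrite (eq_bigr (fun=> I)); last first.
    move=> j _; rewrite /I.
    rewrite (law_rotation (phi := fun y => (y ^+ 2)%:E) (fw j))//.
      by apply/measurable_EFinP; apply: measurable_funX.
    by move=> y; rewrite lee_fin sqr_ge0.
  by rewrite sumr_const card_ord mule_natl.
transitivity (\int[P]_t (fnorm w ^+ 2)%:E)%E; last first.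
  by rewrite integral_cst//= probability_setT mule1.
apply: ae_eq_integral => //.
  by apply: emeasurable_sum.
have := sphere_ae; apply: filterS => t ut _; rewrite sumEFin; congr EFin.
under eq_bigr do rewrite wsE exprMn.
rewrite -mulr_sumr (_ : \sum_j _ = 1) ?mulr1//.
rewrite -[RHS](expr1n _ 2) -ut l2norm_fnorm fnorm_sqr mxdot_cV.
by apply: eq_bigr => j _; rewrite expr2.
Qed.

End Sphere.

(** * Discretization of the samples *)

Section Cells.
Context {R : realType} {n : nat} {d : measure_display} {T : measurableType d}.
Variable P : probability T R.
Variable N : nat.
Hypothesis N0 : (0 < N)%N.

(* Independence is only given as a product rule for events. Rounding every
   sample to the corner of its cell turns all expectations of functions of
   several samples into finite sums, to which this rule applies directly. *)
Definition cell (a : 'cV['I_(2 * N).+1]_n) : set 'cV[R]_n :=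
  [set x | forall j, gridmx a j ord0 <= x j ord0 < gridmx a j ord0 + N%:R^-1].

Lemma measurable_cell a : measurable (cell a).
Proof.
rewrite (_ : cell a = \bigcap_(j in [set: 'I_n]) (setT `&` (fun x : 'cV[R]_n => x j ord0) @^-1`
    [set` `[gridmx a j ord0, (gridmx a j ord0 + N%:R^-1)[ ])); last first.
  apply/seteqP; split => x h j /=.
    by move=> _; split => //; rewrite in_itv/=.
  by have [_ /=] := h j I; rewrite in_itv.
apply: fin_bigcap_measurable; first exact: finite_finset.
by move=> j _; apply: measurable_coord => //; exact: measurable_itv.
Qed.

Lemma cell_inj a b x : cell a x -> cell b x -> a = b.
Proof.
move=> xa xb; apply/colP => j; have := xa j; have := xb j.
have NR : 0 < N%:R :> R by rewrite ltr0n.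
rewrite !mxE /gridpt.
have E (k : 'I_(2 * N).+1) : (k%:R - N%:R) / N%:R + N%:R^-1 = (k%:R - N%:R + 1) / N%:R :> R.
  by rewrite [RHS]mulrDl mul1r.
rewrite !E !ler_pdivrMr// !ltr_pdivlMr// => /andP[b1 b2] /andP[a1 a2].
apply: val_inj; apply/eqP; rewrite eqn_leq.
by apply/andP; split; rewrite -ltnS -(ltr_nat R) -natr1; lra.
Qed.

Variable u : {RV P >-> 'cV[R]_n}.

Lemma measurable_cell_RV a : measurable (u @^-1` cell a).
Proof.
by rewrite -[X in measurable X]setTI; exact: (measurable_funP u _ _ (measurable_cell a)).
Qed.

Definition cell_prob a : R := fine (P (u @^-1` cell a)).

Lemma cell_probE a : (cell_prob a)%:E = P (u @^-1` cell a).
Proof. by rewrite fineK// fin_num_measure//; exact: measurable_cell_RV. Qed.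

Lemma cell_prob_ge0 a : 0 <= cell_prob a.
Proof. by rewrite -lee_fin cell_probE measure_ge0. Qed.

(** [g] of the rounded sample as a simple function. It is 0 where no cell contains the sample, which
    cannot happen on the sphere. *)
Let step (g : 'cV['I_(2 * N).+1]_n -> R) t : R :=
  \sum_a g a * \1_(u @^-1` cell a) t.

Lemma step_in g t a : cell a (u t) -> step g t = g a.
Proof.
move=> ua; rewrite /step (bigD1 a)//= indicE mem_set// mulr1 big1 ?addr0// => b ba.
rewrite indicE memNset ?mulr0// => ub.
by move: ba; rewrite (cell_inj ub ua) eqxx.
Qed.

Lemma step_out g t : ~ (exists a, cell a (u t)) -> step g t = 0.
Proof.
move=> nua; rewrite /step big1// => a _.
by rewrite indicE memNset ?mulr0// => ua; apply: nua; exists a.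
Qed.

Lemma measurable_step g : measurable_fun setT (fun t => (step g t)%:E).
Proof.
apply/measurable_EFinP; apply: measurable_sum => a.
apply: measurable_funM; first exact: measurable_cst.
exact/measurable_indic/measurable_cell_RV.
Qed.

Lemma integral_step g : (forall a, 0 <= g a) ->
  (\int[P]_t (step g t)%:E = (\sum_a cell_prob a * g a)%:E)%E.
Proof.
move=> g0; rewrite -sumEFin.
have mi a : measurable_fun setT (fun t => (\1_(u @^-1` cell a) t : R)%:E).
  by apply/measurable_EFinP; exact/measurable_indic/measurable_cell_RV.
under eq_integral do rewrite /step -sumEFin.
rewrite ge0_integral_sum//=.
- apply: eq_bigr => a _.
  under eq_integral do rewrite EFinM.
  rewrite ge0_integralZl_EFin//=.
  by rewrite integral_indic//= ?setIT -?cell_probE -?EFinM 1?mulrC//; exact: measurable_cell_RV.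
- move=> a; apply/measurable_EFinP; apply: measurable_funM; first exact: measurable_cst.
  exact/measurable_indic/measurable_cell_RV.
- by move=> a t _; rewrite lee_fin mulr_ge0.
Qed.

Lemma cell_prob_sum_le1 : \sum_a cell_prob a <= 1.
Proof.
rewrite -lee_fin.
rewrite (eq_bigr (fun a => cell_prob a * 1)); last by move=> a _; rewrite mulr1.
rewrite -integral_step//; apply: (@le_trans _ _ (\int[P]_t 1)%E); last first.
  by rewrite integral_cst//= probability_setT mule1.
apply: ge0_le_integral => //=.
- by move=> t _; rewrite lee_fin /step sumr_ge0// => a _; rewrite mul1r.
- exact: measurable_step.
- move=> t _; rewrite lee_fin.
  have [[a ua]|nua] := pselect (exists a, cell a (u t)); first by rewrite (step_in _ ua).
  by rewrite step_out.
Qed.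

Hypothesis us : uniform_on_sphere u.

Lemma l2norm1_entry (x : 'cV[R]_n) i : l2norm x = 1 -> `|x i ord0| <= 1.
Proof. by move=> <-; rewrite l2norm_fnorm entry_le_fnorm. Qed.

Lemma cell_exists (x : 'cV[R]_n) : l2norm x = 1 -> exists a, cell a x.
Proof.
move=> x1; have [|a h] := @gridmx_exists R N N0 n 1 x.
  by move=> i j; rewrite ord1 l2norm1_entry.
by exists a => j.
Qed.

Lemma cell_close a x j : cell a x -> `|x j ord0 - gridmx a j ord0| <= N%:R^-1.
Proof. by move=> /(_ j) /andP[h1 h2]; rewrite ger0_norm; lra. Qed.

Hypothesis n0 : (0 < n)%N.
Hypothesis big : (12 * n ^ 3 <= N)%N.

(** Rounding moves a sample by at most n/N. For |w| <= n^2 the exponent changes by at most n^3/N <=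
    1/2, which costs a factor sqrt e <= 2. The second moment loses at most a quarter of |w|^2/n,
    which leaves 3/4. *)
Lemma cell_sphere_like : sphere_like (@gridmx R N n 1) cell_prob.
Proof.
have nR : 1 <= n%:R :> R by rewrite ler1n.
have NR : 0 < N%:R :> R by rewrite ltr0n.
have iN : 0 <= N%:R^-1 :> R by rewrite invr_ge0 ltW.
have bigR : 12 * n%:R ^+ 3 * N%:R^-1 <= 1 :> R.
  by rewrite ler_pdivrMr// mul1r -natrX -natrM ler_nat.
have n23 : n%:R ^+ 2 <= n%:R ^+ 3 :> R by rewrite ler_weXn2l.
have n13 : n%:R ^+ 1 <= n%:R ^+ 3 :> R by rewrite ler_weXn2l.
rewrite expr1 in n13.
have close a x : cell a x -> fnorm (x - gridmx a) <= n%:R * N%:R^-1.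
  move=> xa; rewrite -(ler_pXn2r (n := 2)) ?nnegrE ?fnorm_ge0 ?mulr_ge0//.
  apply: (@le_trans _ _ (n%:R * N%:R^-1 ^+ 2)).
    by apply: fnorm_box => j; have := cell_close j xa; rewrite !mxE.
  by rewrite exprMn ler_wpM2r ?sqr_ge0// expr2 ler_peMl// ltW.
split.
- exact: cell_prob_ge0.
- exact: cell_prob_sum_le1.
- move=> w wn; rewrite -lee_fin -integral_step; last by move=> a; rewrite expR_ge0.
  apply: (@le_trans _ _ (\int[P]_t (2%:E * (expR (mxdot w (u t)))%:E))%E).
    apply: ge0_le_integral => //=.
    + by move=> t _; rewrite lee_fin /step sumr_ge0// => a _; rewrite mulr_ge0 ?expR_ge0.
    + exact: measurable_step.
    + under eq_fun do rewrite -EFinM.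
      apply/measurable_EFinP; apply: measurable_funM; first exact: measurable_cst.
      by apply: measurableT_comp => //; exact: measurable_mxdot_RV.
    + move=> t _; rewrite -EFinM lee_fin.
      have [[a ua]|nua] := pselect (exists a, cell a (u t)); last first.
        by rewrite step_out// mulr_ge0 ?expR_ge0.
      rewrite (step_in _ ua).
      have -> : mxdot w (gridmx a) = (mxdot w (gridmx a) - mxdot w (u t)) + mxdot w (u t).
        by rewrite subrK.
      rewrite expRD ler_wpM2r ?expR_ge0//.
      have h1 : mxdot w (gridmx a) - mxdot w (u t) <= 1 / 2.
        rewrite -mxdotNr -mxdotDr; apply: (le_trans (mxdot_CS _ _)).
        rewrite -opprB -scaleN1r fnormZ normrN1 mul1r.
        apply: (le_trans (ler_pM (fnorm_ge0 _) (fnorm_ge0 _) wn (close _ _ ua))).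
        by rewrite mulrA -exprSr; lra.
      apply: (@le_trans _ _ (expR (1 / 2))); first by rewrite ler_expR.
      have := expR_ge1Dx (- (1 / 2) : R); rewrite expRN => h2.
      rewrite -[leRHS]invrK -[leLHS]invrK lef_pV2 ?posrE ?invr_gt0 ?expR_gt0//; lra.
  rewrite ge0_integralZl_EFin//=.
  + by rewrite EFinM lee_wpmul2l// sphere_mgf.
  + apply/measurable_EFinP; apply: measurableT_comp => //.
    exact: measurable_mxdot_RV.
- move=> w; set f2 := fnorm w ^+ 2.
  have f20 : 0 <= f2 by rewrite sqr_ge0.
  have n1 : 0 < n%:R :> R by lra.
  (* The rounding error is placed inside the step function, so that an almost sure comparison of
     nonnegative integrands suffices. *)
  have : ((f2 / n%:R)%:E <= (\sum_a cell_prob a * (mxdot w (gridmx a) ^+ 2 + f2 / n%:R / 4))%:E)%E.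
    have -> : ((f2 / n%:R)%:E = \int[P]_t (mxdot w (u t) ^+ 2)%:E)%E.
      have := sphere_second_moment us w; rewrite -/f2 => h.
      rewrite mulrC EFinM -h muleA -EFinM mulVf ?gt_eqF// mul1e//.
    rewrite -integral_step; last by move=> a; rewrite addr_ge0 ?sqr_ge0 ?divr_ge0// ltW.
    apply: ae_ge0_le_integral => //=.
    + by move=> t _; rewrite lee_fin sqr_ge0.
    + by apply/measurable_EFinP; apply: measurable_funX; exact: measurable_mxdot_RV.
    + move=> t _; rewrite lee_fin /step sumr_ge0// => a _.
      by rewrite mulr_ge0// addr_ge0 ?sqr_ge0 ?divr_ge0// ltW.
    + exact: measurable_step.
    have := sphere_ae us; apply: filterS => t ut _.
    have [a ua] := cell_exists ut; rewrite (step_in _ ua) lee_fin.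
    have h1 := mxdot_CS_norm w (u t - gridmx a).
    have h2 := close _ _ ua; have f0 := fnorm_ge0 w.
    have x1 : `|mxdot w (u t)| <= fnorm w.
      by apply: (le_trans (mxdot_CS_norm _ _)); rewrite -(l2norm_fnorm (u t)) ut mulr1.
    set e := n%:R * N%:R^-1 in h2.
    have {}h1 : `|mxdot w (u t) - mxdot w (gridmx a)| <= fnorm w * e.
      by rewrite -mxdotNr -mxdotDr; apply: (le_trans h1); rewrite ler_wpM2l.
    have e4 : 2 * e <= n%:R^-1 / 4.
      rewrite ler_pdivlMr// -[leRHS]div1r ler_pdivlMr// /e.
      have : n%:R ^+ 2 * N%:R^-1 <= n%:R ^+ 3 * N%:R^-1 :> R by rewrite ler_wpM2r.
      rewrite -mulrA in bigR; rewrite expr2; lra.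
    have : mxdot w (u t) ^+ 2 - mxdot w (gridmx a) ^+ 2 <= 2 * e * f2.
      move: (mxdot w (u t)) (mxdot w (gridmx a)) x1 h1 => x y x1 h1.
      have -> : x ^+ 2 - y ^+ 2 = 2 * x * (x - y) - (x - y) ^+ 2 by ring.
      apply: (@le_trans _ _ (2 * (`|x| * `|x - y|))).
        apply: (@le_trans _ _ (2 * x * (x - y))); first by rewrite gerBl sqr_ge0.
        by rewrite -mulrA ler_wpM2l// -normrM ler_norm.
      rewrite -mulrA ler_wpM2l//; apply: (le_trans (ler_pM _ _ x1 h1)) => //.
      by rewrite /f2 expr2 mulrCA mulrA [e * _]mulrC mulrA.
    have := ler_wpM2r f20 e4; lra.
  rewrite lee_fin; under eq_bigr do rewrite mulrDr.
  rewrite big_split/= -mulr_suml => h.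
  have q0 : 0 <= f2 / n%:R / 4 by rewrite !divr_ge0// ltW.
  have := ler_wpM2r q0 cell_prob_sum_le1; lra.
Qed.

End Cells.

(** * Exact recovery *)

Section Recovery.
Context {R : realType}.

(** With D = A - H, the pairing of D with its j-th measurement is n^2 (u_j^T D v_j)^2. These terms
    are nonnegative and sum to 0, so each vanishes. *)
Lemma sampling_kernel n M (u v : 'I_M -> 'cV[R]_n) (A H : 'M[R]_n) i :
  (0 < n)%N -> sampling u v A = sampling u v H ->
  mxdot (u i) ((A - H) *m v i) = 0.
Proof.
move=> n0 AH; have M0 : (0 < M)%N by case: (M) i => // -[].
have nR : n%:R ^+ 2 != 0 :> R by rewrite expf_neq0// pnatr_eq0 -lt0n.
pose y i := (u i)^T *m (A - H) *m v i.
have yE j : mxdot (A - H) (measurement (u j) (v j) (A - H)) = n%:R ^+ 2 * mxdot (y j) (y j).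
  rewrite /measurement mxdotZr; congr (_ * _).
  rewrite -mxdot_mulr -!mulmxA -{1}[u j]trmxK -mxdot_mull.
  by rewrite /y !mulmxA.
have : \sum_j mxdot (y j) (y j) = 0.
  apply: (mulfI nR); rewrite mulr0 mulr_sumr; under eq_bigr do rewrite -yE.
  rewrite -mxdot_sumr (_ : \sum_j _ = 0) ?mxdot0r//.
  have -> : \sum_j measurement (u j) (v j) (A - H) =
      M%:R *: (sampling u v A - sampling u v H).
    rewrite /sampling -scalerBr scalerA divff ?pnatr_eq0 -?lt0n// scale1r -sumrB.
    apply: eq_bigr => j _; rewrite /measurement -scalerBr; congr (_ *: _).
    by rewrite mulmxBr !mulmxBl.
  by rewrite AH subrr scaler0.
move/(psumr_eq0P (fun j _ => mxdot_ge0 _)) => /(_ i isT) /mxdot_eq0.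
by rewrite /y /mxdot mulmxA => ->; rewrite mxtrace0.
Qed.

(** A feasible matrix of trace norm at most that of [H] equals [H]. This gives uniqueness, and also
    existence without compactness, as [H] itself is feasible. *)
Lemma recovery_minimizer n M (u v : 'I_M -> 'cV[R]_n) (H : 'M[R]_n) :
  (0 < n)%N ->
  (forall D : 'M[R]_n, (forall i, mxdot (u i) (D *m v i) = 0) ->
     trace_norm (H + D) <= trace_norm H -> D = 0) ->
  trace_norm_minimizer (sampling u v) H H /\
  forall Hhat, trace_norm_minimizer (sampling u v) H Hhat -> Hhat = H.
Proof.
move=> n0 rec.
have uniq A : sampling u v A = sampling u v H -> trace_norm A <= trace_norm H -> A = H.
  move=> AH tA; apply/eqP; rewrite -subr_eq0; apply/eqP; apply: rec.
    by move=> i; apply: sampling_kernel.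
  by rewrite addrC subrK.
split=> [|Hhat [SH /(_ H erefl)]]; last exact: uniq.
split=> // A SA; rewrite leNgt; apply/negP => tA.
by have := uniq _ SA (ltW tA) => AH; rewrite AH ltxx in tA.
Qed.

(* Chosen as some [k] with [3 (c + L) < c sqrt k], where [c] and [L] are
   the isometry constants of [good_config_rip]; the blocks have length [k r]. *)
Definition block_factor : nat :=
  (Num.truncn ((3 * (rip_lower / 4 + (2 * rip_upper + 1)) / (rip_lower / 4)) ^+ 2 : R)).+1.

(** The quotient gives the fineness asked by [good_config_rip], where K is at most [block_factor]
    times n; the summand 13 secures 12 n^3 <= N for [cell_sphere_like]. *)
Definition grid_factor : nat :=
  (Num.truncn (24 * block_factor%:R / rip_lower : R) + 13)%N.

(* The exponent [e] for which the grid of spacing [1 / (grid_factor * n ^ 4)] has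
   at most [n ^ e] points per coordinate, when [n >= 2]. *)
Definition grid_exponent : R := ln (3 * grid_factor%:R) / ln 2 + 4.

(** Makes [rip_rate] M exceed the logarithm of the net's size plus ln 2 + ln n. The summand 2 pays
    for these two logarithms, and ln 2 in the denominator allows for ln n / ln 2 >= 1 when comparing
    ln n with its square. *)
Definition sample_factor : R :=
  (2 + 2 * block_factor%:R * grid_exponent) / (rip_rate * ln 2).

Lemma empirical_recovery n r M (u v : 'I_M -> 'cV[R]_n) (D : 'M[R]_n) :
  (0 < r)%N ->
  (forall A B : 'M[R]_(n, block_factor * r),
    (forall i j, `|A i j| <= 1) -> (forall i j, `|B i j| <= 1) ->
    fnorm (A *m B^T) = 1 ->
    rip_lower / 4 <= empirical u v (A *m B^T) <= 2 * rip_upper + 1) ->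
  trace_norm D <= 3 * Num.sqrt r%:R * fnorm D ->
  (forall i, mxdot (u i) (D *m v i) = 0) -> D = 0.
Proof.
move=> r0 rip cone uD.
have c0 := @rip_lower_gt0 R; have L0 := @rip_upper_ge0 R.
apply: (block_recovery _ _ rip _ _ _ cone) => //.
- move=> X Y; rewrite /empirical -mulrDr ler_wpM2l ?invr_ge0// -big_split/=.
  apply: ler_sum => i _; rewrite -mulrDr ler_wpM2l// mulmxDl mxdotDr.
  exact: ler_normD.
- move=> a X; rewrite /empirical mulrCA; congr (_ * _); rewrite mulr_sumr.
  by apply: eq_bigr => i _; rewrite -scalemxAl mxdotZr normrM mulrCA.
- by rewrite muln_gt0.
- by rewrite divr_gt0.
- lra.
- have rs : 0 < Num.sqrt r%:R :> R by rewrite sqrtr_gt0 ltr0n.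
  rewrite natrM sqrtrM// [ltLHS]mulrAC [ltRHS]mulrA ltr_pM2r//.
  set t := 3 * _; have c4 : 0 < rip_lower / 4 :> R by rewrite divr_gt0.
  have t0 : 0 <= t by rewrite /t mulr_ge0//; lra.
  have tc : 0 <= t / (rip_lower / 4) by rewrite divr_ge0// ltW.
  rewrite mulrC -ltr_pdivrMr// -[ltLHS](ger0_norm tc) -sqrtr_sqr.
  rewrite ltr_sqrt; first exact: truncnS_gt.
  by rewrite ltr0n.
- rewrite /empirical big1 ?mulr0// => i _.
  by rewrite uD normr0 mulr0.
Qed.

Lemma net_tail n r M : (1 < n)%N -> (0 < r)%N ->
  sample_factor * n%:R * r%:R ^+ 2 * ln n%:R ^+ 2 < M%:R ->
  ((2 * (grid_factor * n ^ 4)).+1 ^ (2 * (n * (block_factor * r))))%N%:R *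
    (2 * expR (- (rip_rate * M%:R))) < n%:R^-1 :> R.
Proof.
move=> n1 r0 big; set N := (grid_factor * n ^ 4)%N.
have B0 : (0 < grid_factor)%N by rewrite /grid_factor addnS.
have nR : 2 <= n%:R :> R by rewrite (ler_nat R 2).
have rR : 1 <= r%:R :> R by rewrite ler1n.
have BR : 1 <= grid_factor%:R :> R by rewrite ler1n.
have l2 : 0 < ln 2 :> R by rewrite ln_gt0//; lra.
have n0 : 0 < n%:R :> R by lra.
have ln2n : ln 2 <= ln n%:R :> R by rewrite ler_ln ?posrE.
have lN : ln (2 * N).+1%:R <= grid_exponent * ln n%:R.
  apply: (@le_trans _ _ (ln (3 * grid_factor%:R * n%:R ^+ 4))).
    rewrite ler_ln ?posrE ?ltr0n ?mulr_gt0 ?exprn_gt0//; last by lra.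
    rewrite -natrX -!natrM ler_nat -mulnA -/N.
    have : (0 < N)%N by rewrite muln_gt0 B0 expn_gt0 (ltnW n1).
    by move: (N) => k; lia.
  rewrite lnM ?posrE ?exprn_gt0 ?mulr_gt0//; last by lra.
  rewrite lnXn// /grid_exponent [leRHS]mulrDl -[ln n%:R *+ 4]mulr_natl lerD2r.
  rewrite mulrAC ler_pdivlMr// ler_wpM2l// ln_ge0//; lra.
have N0 : 0 < (2 * N).+1%:R :> R by rewrite ltr0n.
have -> : n%:R^-1 = expR (- ln n%:R) :> R by rewrite expRN lnK.
set e := (2 * (n * (block_factor * r)))%N.
have -> : ((2 * N).+1 ^ e)%N%:R = expR (e%:R * ln (2 * N).+1%:R) :> R.
  by rewrite expRM_natl lnK// natrX.
have -> : 2 * expR (- (rip_rate * M%:R)) = expR (ln 2 - rip_rate * M%:R) :> R.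
  by rewrite expRD lnK ?posrE.
rewrite -expRD ltr_expR.
have k0 := @rip_rate_gt0 R; have ln0 : 0 < ln n%:R :> R by apply: lt_le_trans ln2n.
have g0 : 0 <= grid_exponent.
  by rewrite addr_ge0// divr_ge0 ?(ltW l2)// ln_ge0//; lra.
have f0 : 0 <= sample_factor.
  by rewrite divr_ge0 ?mulr_ge0 ?addr_ge0 ?mulr_ge0// ltW.
have nr : 1 <= n%:R * r%:R :> R.
  by rewrite -natrM ler1n muln_gt0 r0 (ltnW n1).
have t1 : e%:R * ln (2 * N).+1%:R <=
    2 * block_factor%:R * grid_exponent * (n%:R * r%:R * ln n%:R).
  apply: (le_trans (ler_wpM2l (ler0n _ _) lN)); rewrite /e !natrM.
  by rewrite le_eqVlt; apply/orP; left; apply/eqP; ring.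
have t2 : ln n%:R <= n%:R * r%:R * ln n%:R :> R by rewrite ler_peMl// ltW.
have t3 : (2 + 2 * block_factor%:R * grid_exponent) * (n%:R * r%:R * ln n%:R) <=
    rip_rate * (sample_factor * n%:R * r%:R ^+ 2 * ln n%:R ^+ 2).
  have -> : rip_rate * (sample_factor * n%:R * r%:R ^+ 2 * ln n%:R ^+ 2) =
      (2 + 2 * block_factor%:R * grid_exponent) * (n%:R * r%:R * ln n%:R) *
      (r%:R * (ln n%:R / ln 2)).
    by rewrite /sample_factor; field; rewrite !gt_eqF.
  rewrite ler_peMr//.
    by rewrite mulr_ge0 ?addr_ge0 ?mulr_ge0// ltW.
  by rewrite -[leLHS]mulr1 ler_pM// ler_pdivlMr// mul1r.
have t4 : rip_rate * (sample_factor * n%:R * r%:R ^+ 2 * ln n%:R ^+ 2) < rip_rate * M%:R.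
  by rewrite ltr_pM2l.
lra.
Qed.

End Recovery.

(** * The event of exact recovery *)

Section Event.
Context {R : realType} {d : measure_display} {T : measurableType d}.
Variable P : probability T R.

Lemma measure_fin_bigcup_le (I : finType) (Q : pred I) (A : I -> set T) :
  (forall i, measurable (A i)) ->
  (P (\bigcup_(i in [set i | Q i]) A i) <= \sum_(i | Q i) P (A i))%E.
Proof.
move=> mA.
have seqP (s : seq I) : measurable (\bigcup_(i in [set` s]) A i) /\
    (P (\bigcup_(i in [set` s]) A i) <= \sum_(i <- s) P (A i))%E.
  elim: s => [|x s [ms IHs]].
    by rewrite set_nil bigcup_set0 big_nil measure0.
  have -> : [set` x :: s] = x |` [set` s].
    apply/seteqP; split=> y /=; rewrite in_cons.
      by case/orP => [/eqP->|]; [left|right].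
    by case=> [->|->]; rewrite ?eqxx ?orbT.
  rewrite bigcup_setU1 big_cons; split; first exact: measurableU.
  by apply: (le_trans (measureU2 _ _ _)) => //; rewrite leeD2l.
have [_] := seqP (enum Q); rewrite big_enum/=; congr (_ <= _)%E.
by congr (P _); apply: eq_bigcupl => /=; split=> i /=; rewrite mem_enum.
Qed.

Context {n M : nat} (u v : 'I_M -> {RV P >-> 'cV[R]_n}).
Hypothesis uv : indep_uniform_samples u v.

Lemma off_sphere_null (x : {RV P >-> 'cV[R]_n}) : uniform_on_sphere x ->
  measurable [set w | l2norm (x w) != 1] /\ P [set w | l2norm (x w) != 1] = 0%E.
Proof.
move=> xs; have m : measurable [set w | l2norm (x w) = 1].
  by rewrite -[X in measurable X]setTI; exact: (measurable_funP x _ _ measurable_sphere).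
have -> : [set w | l2norm (x w) != 1] = ~` [set w | l2norm (x w) = 1].
  by apply/seteqP; split=> w /= /eqP.
by rewrite probability_setC// xs.1 subee//; split=> //; exact: measurableC.
Qed.

(** Discarded because samples of norm 1 are the ones known to lie in some cell. *)
Definition off_sphere : set T :=
  \bigcup_(i in [set: 'I_M]) ([set w | l2norm (u i w) != 1] `|` [set w | l2norm (v i w) != 1]).

Lemma off_sphereP : measurable off_sphere /\ P off_sphere = 0%E.
Proof.
have [us vs _] := uv.
have mA i : measurable ([set w | l2norm (u i w) != 1] `|` [set w | l2norm (v i w) != 1]).
  by apply: measurableU; [have [] := off_sphere_null (us i)|have [] := off_sphere_null (vs i)].
split; first by apply: fin_bigcup_measurable => //; exact: finite_finset.
apply/eqP; rewrite eq_le measure_ge0 andbT /off_sphere.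
have := measure_fin_bigcup_le xpredT mA.
rewrite (_ : [set i | xpredT i] = [set: 'I_M]); last by apply/seteqP.
move/le_trans; apply; rewrite big1// => i _; apply/eqP; rewrite eq_le measure_ge0 andbT.
have [mu1 pu1] := off_sphere_null (us i); have [mv1 pv1] := off_sphere_null (vs i).
by apply: (le_trans (measureU2 P mu1 mv1)); rewrite /= pu1 pv1 adde0.
Qed.

Lemma off_sphereN w : ~ off_sphere w ->
  forall i, l2norm (u i w) = 1 /\ l2norm (v i w) = 1.
Proof.
move=> ow i; split; apply: contra_notP ow => /eqP h; exists i => //.
  by left.
by right.
Qed.

Variable N : nat.
Hypothesis N0 : (0 < N)%N.

Let code := {ffun 'I_M -> 'cV['I_(2 * N).+1]_n * 'cV['I_(2 * N).+1]_n}.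

Definition config_cell (phi : code) : set T :=
  \bigcap_(i in [set: 'I_M]) (u i @^-1` cell (phi i).1 `&` v i @^-1` cell (phi i).2).

Lemma measurable_config_cell phi : measurable (config_cell phi).
Proof.
apply: fin_bigcap_measurable => [|i _]; first exact: finite_finset.
by apply: measurableI; exact: measurable_cell_RV.
Qed.

(** The one place where independence enters: the product rule for all 2M vectors turns the law of
    the rounded samples into the product weights of the finite sums. *)
Lemma config_cell_prob phi : P (config_cell phi) =
  (\prod_i (cell_prob (u i) (phi i).1 * cell_prob (v i) (phi i).2))%:E.
Proof.
have [_ _ ind] := uv.
have := ind [set: 'I_M + 'I_M]%SET
  (fun k => match k with inl i => cell (phi i).1 | inr i => cell (phi i).2 end).
have mc (k : 'I_M + 'I_M) : measurable
    (match k with inl i => cell (phi i).1 | inr i => cell (phi i).2 end : set 'cV[R]_n).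
  by case: k => i; exact: measurable_cell.
move=> /(_ mc).
rewrite big_sumType/= => h.
transitivity (\prod_(i < M) P (u i @^-1` cell (phi i).1) *
              \prod_(i < M) P (v i @^-1` cell (phi i).2))%E.
  apply: etrans (etrans h _); last first.
    by congr (_ * _)%E; apply: eq_bigl => i; rewrite finset.in_setT.
  congr (P _); apply/seteqP; split=> w /=.
    by move=> cw [] i _ /=; have [] := cw i I.
  move=> cw i _; split.
    by have := cw (inl i); apply; rewrite /= finset.in_setT.
  by have := cw (inr i); apply; rewrite /= finset.in_setT.
rewrite big_split/= EFinM; congr (_ * _)%E; rewrite -prodEFin; apply: eq_bigr => i _;
  by rewrite cell_probE.
Qed.

(** The event is the complement of finitely many bad configuration cells and a null set, hence
    measurable; the union bound over the net controls its complement. *)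
Lemma good_event K : (0 < n)%N -> (12 * n ^ 3 <= N)%N ->
  ((2 * N).+1 ^ (2 * (n * K)))%N%:R * (2 * expR (- (rip_rate * M%:R))) < n%:R^-1 :> R ->
  exists E : set T, [/\ measurable E, ((1 - n%:R^-1)%:E < P E)%E &
    forall w, E w -> ~ off_sphere w /\
      exists2 phi : code, @good_config R _ _ K _ phi & config_cell phi w].
Proof.
move=> n0 big tail; have [us vs _] := uv.
pose bad := \bigcup_(phi in [set phi : code | ~~ @good_config R _ _ K _ phi]) config_cell phi.
have mbad : measurable bad.
  apply: fin_bigcup_measurable => [|phi _]; first exact: finite_finset.
  exact: measurable_config_cell.
have [moff off0] := off_sphereP.
exists (~` (bad `|` off_sphere)); split.
- by apply: measurableC; exact: measurableU.
- rewrite probability_setC; last exact: measurableU.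
  have Pbad : (P bad <= (\sum_(phi : code | ~~ @good_config R _ _ K _ phi)
     \prod_i (cell_prob (u i) (phi i).1 * cell_prob (v i) (phi i).2))%:E)%E.
    apply: (le_trans (measure_fin_bigcup_le _ measurable_config_cell)).
    rewrite -sumEFin le_eqVlt; apply/orP; left; apply/eqP.
    by apply: eq_bigr => phi _; rewrite config_cell_prob.
  have Pall : (P (bad `|` off_sphere) <= P bad)%E.
    by apply: (le_trans (measureU2 P mbad moff)); rewrite /= off0 adde0.
  have := le_lt_trans (bad_config_tail K n0 N0
    (fun i => cell_sphere_like N0 (us i) n0 big)
    (fun i => cell_sphere_like N0 (vs i) n0 big)) tail.
  rewrite -lte_fin => lt; have {lt} := le_lt_trans (le_trans Pall Pbad) lt.
  have : P (bad `|` off_sphere) \is a fin_num.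
    by apply: fin_num_measure; exact: measurableU.
  move/fineK <-; rewrite -EFinB !lte_fin; lra.
- move=> w ow; have off : ~ off_sphere w by move=> h; apply: ow; right.
  split=> //; have sp := off_sphereN off.
  have ex i := cell_exists N0 (sp i).1; have ex' i := cell_exists N0 (sp i).2.
  pose phi : code := [ffun i => (sval (cid (ex i)), sval (cid (ex' i)))].
  have cphi : config_cell phi w.
    by move=> i _; rewrite /phi ffunE /=; split; [case: (cid (ex i))|case: (cid (ex' i))].
  exists phi => //; apply: contra_notT ow => bphi.
  by left; exists phi.
Qed.

End Event.

Lemma recovery_event (R : realType) (n : nat) (H : 'M[R]_n) (M : nat)
    (d : measure_display) (T : measurableType d) (P : probability T R)
    (u v : 'I_M -> {RV P >-> 'cV[R]_n}) :
  (0 < n)%N -> (0 < M)%N -> H^T = H -> indep_uniform_samples u v ->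
  sample_factor * n%:R * (\rank H)%:R ^+ 2 * ln n%:R ^+ 2 < M%:R :> R ->
  exists E : set T, [/\ measurable E, ((1 - n%:R^-1)%:E < P E)%E &
    forall w, E w -> forall D : 'M[R]_n,
      (forall i, mxdot (u i w) (D *m v i w) = 0) ->
      trace_norm (H + D) <= trace_norm H -> D = 0].
Proof.
move=> n0 M0 HT uv big; set r := \rank H in big.
have nR : 0 < n%:R^-1 :> R by rewrite invr_gt0 ltr0n.
(* For rank 0 the cone condition alone forces D = 0. *)
have [r0|r0] := posnP r.
  exists setT; split => //; first by rewrite probability_setT lte_fin; lra.
  move=> w _ D _ /(trace_norm_cone HT); rewrite -/r r0 sqrtr0 mulr0 mul0r => t0.
  by apply: trace_norm_eq0; apply/eqP; rewrite eq_le t0 trace_norm_ge0.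
have [n1|n1] := leqP n 1.
  have {}n1 : n = 1%N by apply/eqP; rewrite eqn_leq n1.
  subst n; have [moff off0] := off_sphereP uv.
  exists (~` off_sphere u v); split; first exact: measurableC.
    by rewrite probability_setC// off0 sube0 lte_fin; lra.
  move=> w /off_sphereN sp D /(_ (Ordinal M0)) uDv _.
  have [su sv] := sp (Ordinal M0).
  have unit (x : 'cV[R]_1) : l2norm x = 1 -> x 0 0 != 0.
    rewrite l2norm_fnorm => x1; apply/eqP => x0; move: x1.
    by rewrite /fnorm mxdot_cV big_ord1 x0 mul0r sqrtr0 => /eqP; rewrite eq_sym oner_eq0.
  move: uDv; rewrite mxdot_cV big_ord1 mxE big_ord1 => /eqP.
  rewrite !mulf_eq0 (negPf (unit _ su)) (negPf (unit _ sv)) orbF => /eqP D0.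
  by apply/matrixP => i j; rewrite !ord1 mxE.
pose N := (@grid_factor R * n ^ 4)%N; pose K := (@block_factor R * r)%N.
have B12 : (12 < @grid_factor R)%N by rewrite /grid_factor addnC ltn_addr.
have N0 : (0 < N)%N by rewrite muln_gt0 expn_gt0 n0 (leq_trans _ B12).
have N12 : (12 * n ^ 3 <= N)%N.
  by rewrite /N leq_mul ?leq_pexp2l// ltnW.
have N24 : 24 * n%:R ^+ 3 * K%:R <= rip_lower * N%:R :> R.
  have c0 := @rip_lower_gt0 R.
  have h : 24 * (@block_factor R)%:R <= rip_lower * (@grid_factor R)%:R :> R.
    rewrite [leRHS]mulrC -ler_pdivrMr// /grid_factor natrD.
    by have := @truncnS_gt R (24 * (@block_factor R)%:R / rip_lower); rewrite -natr1; lra.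
  have rn : r%:R <= n%:R :> R by rewrite ler_nat rank_leq_row.
  have -> : N%:R = (@grid_factor R)%:R * n%:R ^+ 4 :> R by rewrite /N natrM natrX.
  have -> : K%:R = (@block_factor R)%:R * r%:R :> R by rewrite /K natrM.
  rewrite [leRHS]mulrA; apply: le_trans (ler_wpM2r _ h); last first.
    by rewrite exprn_ge0.
  rewrite (_ : 24 * _ * _ = 24 * (@block_factor R)%:R * n%:R ^+ 3 * r%:R); last by ring.
  by rewrite [n%:R ^+ 4]exprSr [leRHS]mulrA ler_wpM2l// !mulr_ge0// exprn_ge0.
have [E [mE PE EP]] := good_event uv N0 n0 N12 (net_tail n1 r0 big).
exists E; split => // w /EP[off [phi gphi cphi]] D uD /(trace_norm_cone HT) cone.
have sp := off_sphereN off.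
apply: (@empirical_recovery _ n r M (fun i => u i w) (fun i => v i w)) => //.
apply: (good_config_rip n0 N0 _ M0 N24 gphi).
- by rewrite muln_gt0.
- by move=> i j; apply: l2norm1_entry; case: (sp i).
- by move=> i j; apply: l2norm1_entry; case: (sp i).
- by move=> i j; apply: cell_close; case: (cphi i I).
- by move=> i j; apply: cell_close; case: (cphi i I).
Qed.

Theorem corollary1 (R : realType) :
  exists C : R,
  forall (n r : nat), (0 < n)%N ->
  forall (delta eps : R) (x : 'cV[R]_n) (f : 'cV[R]_n -> R) (H : 'M[R]_n),
  0 < delta -> 0 <= eps -> C2 f ->
  H^T = H -> \rank H = r -> opnorm (H - hessian f x) <= eps ->
  (forall (d : measure_display) (T : measurableType d) (P : probability T R)
     (u v : {RV P >-> 'cV[R]_n}),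
     indep_uniform_pair u v ->
     eq_in_law P
       (fun w => second_difference f delta x (u w) (v w) *: (u w *m (v w)^T))
       (fun w => u w *m (u w)^T *m H *m v w *m (v w)^T)) ->
  forall (M : nat) (d : measure_display) (T : measurableType d)
    (P : probability T R) (u v : 'I_M -> {RV P >-> 'cV[R]_n}),
  (0 < M)%N ->
  indep_uniform_samples u v ->
  C * n%:R * r%:R ^+ 2 * ln n%:R ^+ 2 < M%:R ->
  exists E : set T,
    [/\ measurable E,
        ((1 - n%:R^-1)%:E < P E)%E &
        forall w, E w ->
          let S := sampling (fun i => u i w) (fun i => v i w) in
          (exists Hhat, trace_norm_minimizer S H Hhat) /\
          forall Hhat, trace_norm_minimizer S H Hhat ->
            opnorm (Hhat - hessian f x) <= eps].
Proof.
exists sample_factor => n r n0 delta eps x f H _ _ _ HT Hr Heps _ M d T P u v M0 uv big.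
rewrite -Hr in big.
have [E [mE PE EP]] := recovery_event n0 M0 HT uv big.
exists E; split => // w /EP rec S.
have [minH uniqH] := recovery_minimizer n0 rec.
split; first by exists H.
by move=> Hhat /uniqH ->.
Qed.
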